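(* Let $G$ be a Lie group with Lie algebra $\mathfrak{g}$, and let $G$ act non-trivially by quaternionic automorphisms on a connected integrable quaternionic manifold $M$ of dimension $4n$. Then $\dim_{\mathbb{R}}(\rho_{\min,\mathfrak{g}})\le 4n+4=\dim(M)+4$.
   Context: Representations are finite dimensional. A representation $\rho:\mathfrak{g}\to\mathrm{End}_{\mathbb{C}}(V)$ ($\mathbb{R}$-linear Lie algebra homomorphism, $V$ a complex vector space) is quaternionic if there is a $\rho$-equivariant antilinear map $J:V\to V$ with $J^2=-1$. A complex linear representation of $\mathfrak{g}_{\mathbb{C}}=\mathfrak{g}\otimes_{\mathbb{R}}\mathbb{C}$ is $\mathfrak{g}$-quaternionic if its restriction to $\mathfrak{g}$ is quaternionic. $\rho_{\min,\mathfrak{g}}$ denotes the (non-trivial) $\mathfrak{g}$-quaternionic representation of $\mathfrak{g}_{\mathbb{C}}$ of minimal dimension, i.e. the complex linear extension of the (non-trivial) quaternionic representation of $\mathfrak{g}$ of minimal dimension, and $\dim_{\mathbb{R}}(\rho_{\min,\mathfrak{g}})$ is the real dimension of its representation space. $\mathbb{H}$ denotes the quaternions. Fix an $\mathbb{R}$-linear identification $\mathbb{H}^n\cong\mathbb{R}^{4n}$ of the right quaternionic vector space $\mathbb{H}^n$; $\mathrm{GL}(n,\mathbb{H})\cdot\mathbb{H}^*\subset \mathrm{GL}(4n,\mathbb{R})$ is the group of maps $v\mapsto Avq$ with $A\in\mathrm{GL}(n,\mathbb{H})$, $q\in\mathbb{H}^*$. An almost quaternionic structure on a smooth manifold $M^{4n}$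 is a principal $\mathrm{GL}(n,\mathbb{H})\cdot\mathbb{H}^*$-subbundle $\mathcal{B}(M)$ of the frame bundle of $M$. It is integrable if around every point there is a coordinate chart $(x_1,\dots,x_{4n})$ such that $(\partial/\partial x_1,\dots,\partial/\partial x_{4n})$ is a section of $\mathcal{B}(M)$. An integrable quaternionic manifold is a smooth manifold with an integrable almost quaternionic structure. A quaternionic automorphism of $M$ is a diffeomorphism of $M$ whose induced map on the frame bundle preserves $\mathcal{B}(M)$.
   Formalization: ''G acts non-trivially'' is taken to mean that the identity component of G acts non-trivially (automatic for connected G); for disconnected G the literal claim fails, e.g. Z/2 × Sp(m) with m > n+1, Sp(m) acting trivially and Z/2 acting non-trivially on HP^n. *)

(* Defs.v *)
From HB Require Import structures.
From mathcomp Require Import all_boot all_order all_algebra.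
From mathcomp Require Import all_classical all_reals all_analysis.
From mathcomp Require Import complex ring.

Set Implicit Arguments.
Unset Strict Implicit.
Unset Printing Implicit Defensive.

Import Order.TTheory GRing.Theory Num.Theory.
Import numFieldNormedType.Exports.

Local Open Scope classical_set_scope.
Local Open Scope ring_scope.
Local Open Scope complex_scope.

(* The skew field of quaternions [Quat a b c d = a + b i + c j + d k]. *)
Record quat (R : Type) := Quat { q0 : R; q1 : R; q2 : R; q3 : R }.

Section QuaternionRing.
Variable R : realType.
Implicit Types x y z : quat R.

Definition quat_tuple x := (q0 x, q1 x, q2 x, q3 x).
Definition tuple_quat (t : R * R * R * R) : quat R :=
  Quat t.1.1.1 t.1.1.2 t.1.2 t.2.
Lemma quat_tupleK : cancel quat_tuple tuple_quat. Proof. by case. Qed.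
HB.instance Definition _ := Choice.copy (quat R) (can_type quat_tupleK).

Definition addq x y := Quat (q0 x + q0 y) (q1 x + q1 y) (q2 x + q2 y) (q3 x + q3 y).
Definition oppq x := Quat (- q0 x) (- q1 x) (- q2 x) (- q3 x).
Definition mulq x y := Quat
  (q0 x * q0 y - q1 x * q1 y - q2 x * q2 y - q3 x * q3 y)
  (q0 x * q1 y + q1 x * q0 y + q2 x * q3 y - q3 x * q2 y)
  (q0 x * q2 y - q1 x * q3 y + q2 x * q0 y + q3 x * q1 y)
  (q0 x * q3 y + q1 x * q2 y - q2 x * q1 y + q3 x * q0 y).

Lemma addqA : associative addq.
Proof. by case=> ? ? ? ? [? ? ? ?] [? ? ? ?]; rewrite /addq /= !addrA. Qed.
Lemma addqC : commutative addq.
Proof. by case=> ? ? ? ? [? ? ? ?]; congr Quat; apply: addrC. Qed.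
Lemma add0q : left_id (Quat 0 0 0 0) addq.
Proof. by case=> ? ? ? ?; rewrite /addq /= !add0r. Qed.
Lemma addNq : left_inverse (Quat 0 0 0 0) oppq addq.
Proof. by case=> ? ? ? ?; rewrite /addq /= !addNr. Qed.
HB.instance Definition _ := GRing.isZmodule.Build (quat R) addqA addqC add0q addNq.

Lemma mulqA : associative mulq.
Proof. by case=> ? ? ? ? [? ? ? ?] [? ? ? ?]; rewrite /mulq /=; congr Quat; ring. Qed.
Lemma mul1q : left_id (Quat 1 0 0 0) mulq.
Proof. by case=> ? ? ? ?; rewrite /mulq /=; congr Quat; ring. Qed.
Lemma mulq1 : right_id (Quat 1 0 0 0) mulq.
Proof. by case=> ? ? ? ?; rewrite /mulq /=; congr Quat; ring. Qed.
Lemma mulqDl : left_distributive mulq +%R.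
Proof. by case=> ? ? ? ? [? ? ? ?] [? ? ? ?]; congr Quat; rewrite /=; ring. Qed.
Lemma mulqDr : right_distributive mulq +%R.
Proof. by case=> ? ? ? ? [? ? ? ?] [? ? ? ?]; congr Quat; rewrite /=; ring. Qed.
Lemma oneq_neq0 : Quat 1 0 0 0 != 0 :> quat R.
Proof. by apply/eqP => -[/eqP]; rewrite oner_eq0. Qed.
HB.instance Definition _ := GRing.Zmodule_isNzRing.Build (quat R)
  mulqA mul1q mulq1 mulqDl mulqDr oneq_neq0.

End QuaternionRing.

Section QuaternionicGroup.
Variables (R : realType) (n : nat).

(* The identification of R^{4n} with H^n: the i-th quaternion is read off the
   i-th column of the 4 x n array underlying the vector. *)
Definition to_Hn (v : 'rV[R]_(4 * n)) : 'cV[quat R]_n :=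
  let A := vec_mx v : 'M[R]_(4, n) in
  \col_i Quat (A (inord 0) i) (A (inord 1) i) (A (inord 2) i) (A (inord 3) i).

(* GL(n,H).H^*, as a set of real matrices acting on row vectors: the maps
   v |-> A v q. *)
Definition GLnH_Hstar : set 'M[R]_(4 * n) :=
  [set P | exists A B : 'M[quat R]_n, exists q : quat R,
     [/\ A *m B = 1%:M, B *m A = 1%:M, q != 0 &
         forall v, to_Hn (v *m P) = map_mx (fun h => h * q) (A *m to_Hn v)]].

End QuaternionicGroup.

Section Smooth.
Variable R : realType.

Fixpoint Ck (E F : normedModType R) (k : nat) (U : set E) (f : E -> F) : Prop :=
  if k is k'.+1 then
    (forall x, U x -> differentiable f x) /\ (forall v, Ck k' U ('D_v f))
  else forall x, U x -> {for x, continuous f}.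

(* Only meant for open U. *)
Definition Cinfty (E F : normedModType R) (U : set E) (f : E -> F) :=
  forall k, Ck k U f.

(* A chart is a partial homeomorphism; the values of [chart_map] outside
   [chart_dom] and of [chart_inv] outside the image are irrelevant. *)
Record chart (T E : Type) := Chart {
  chart_dom : set T;
  chart_map :> T -> E;
  chart_inv : E -> T }.

Definition is_chart (T : topologicalType) (E : normedModType R) (phi : chart T E) :=
  [/\ open (chart_dom phi),
      open (phi @` chart_dom phi),
      forall x, chart_dom phi x -> chart_inv phi (phi x) = x,
      forall x, chart_dom phi x -> {for x, continuous phi} &
      forall y, (phi @` chart_dom phi) y -> {for y, continuous (chart_inv phi)}].

Definition smooth_in_charts (T T' : Type) (E E' : normedModType R) (f : T -> T')
    (phi : chart T E) (psi : chart T' E') :=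
  Cinfty (phi @` (chart_dom phi `&` f @^-1` chart_dom psi))
         (psi \o f \o chart_inv phi).

Record manifold (d : nat) := Manifold {
  mf_sort :> topologicalType;
  atlas : set (chart mf_sort 'rV[R]_d);
  mf_hausdorff : hausdorff_space mf_sort;
  mf_second_countable : @second_countable mf_sort;
  atlas_chart : forall phi, atlas phi -> is_chart phi;
  atlas_cover : forall x, exists phi, atlas phi /\ chart_dom phi x;
  atlas_compat : forall phi psi, atlas phi -> atlas psi ->
    smooth_in_charts id phi psi;
  atlas_maximal : forall phi, is_chart phi ->
    (forall psi, atlas psi ->
       smooth_in_charts id phi psi /\ smooth_in_charts id psi phi) ->
    atlas phi }.

Definition smooth_map (T T' : topologicalType) (E E' : normedModType R)
    (A : set (chart T E)) (A' : set (chart T' E')) (f : T -> T') :=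
  continuous f /\
  forall phi psi, A phi -> A' psi -> smooth_in_charts f phi psi.

Definition prod_chart (T T' E E' : Type) (phi : chart T E) (psi : chart T' E') :
    chart (T * T') (E * E') :=
  Chart (chart_dom phi `*` chart_dom psi)
        (fun p => (phi p.1, psi p.2))
        (fun q => (chart_inv phi q.1, chart_inv psi q.2)).

(* Not maximal, but it determines the product smooth structure. *)
Definition prod_atlas (T T' E E' : Type)
    (A : set (chart T E)) (A' : set (chart T' E')) : set (chart (T * T') (E * E')) :=
  [set chi | exists phi psi, [/\ A phi, A' psi & chi = prod_chart phi psi]].

Definition diffeomorphism d d' (M : manifold d) (N : manifold d') (f : M -> N) :=
  smooth_map (atlas (m := M)) (atlas (m := N)) f /\
  exists g : N -> M, [/\ smooth_map (atlas (m := N)) (atlas (m := M)) g,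
                         cancel f g & cancel g f].

(* A chart chosen once and for all around each point x: the tangent space T_xM
   is identified with R^d (row vectors) through this chart. *)
Definition chart_at d (M : manifold d) (x : M) : chart M 'rV[R]_d :=
  sval (cid (atlas_cover x)).

(* Matrix (acting on row vectors) of the differential T_xM -> T_{f x}N. *)
Definition tangent_map d d' (M : manifold d) (N : manifold d') (f : M -> N) (x : M) :
    'M[R]_(d, d') :=
  jacobian (chart_at (f x) \o f \o chart_inv (chart_at x)) (chart_at x x).

(* A frame of T_xM is an invertible matrix F, whose rows are the frame vectors;
   equivalently, it is the isomorphism v |-> v *m F from R^d to T_xM. *)
Definition coordinate_frame d (M : manifold d) (phi : chart M 'rV[R]_d) (x : M) :
    'M[R]_d :=
  jacobian (chart_at x \o chart_inv phi) (phi x).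

End Smooth.

Section QuaternionicManifold.
Variables (R : realType) (n : nat).

(* [aq_frames x] is the fibre over x of a principal GL(n,H).H^*-subbundle of the
   frame bundle: a single orbit of the structure group (acting on frames
   R^{4n} -> T_xM by precomposition), with smooth local sections. *)
Record almost_quaternionic (M : manifold R (4 * n)) := AlmostQuaternionic {
  aq_frames :> M -> set 'M[R]_(4 * n);
  aq_unit : forall x F, aq_frames x F -> F \in unitmx;
  aq_orbit : forall x F F', aq_frames x F ->
    (aq_frames x F' <-> exists2 P, GLnH_Hstar P & F' = P *m F);
  aq_section : forall x, exists phi U (S : M -> 'M[R]_(4 * n)),
    [/\ atlas phi, open_nbhs x U, U `<=` chart_dom phi,
        Cinfty (phi @` U) (S \o chart_inv phi) &
        forall y, U y -> aq_frames y (S y *m coordinate_frame phi y)] }.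

Definition integrable_aq (M : manifold R (4 * n)) (B : almost_quaternionic M) :=
  forall x : M, exists phi,
    [/\ atlas phi, chart_dom phi x &
        forall y, chart_dom phi y -> B y (coordinate_frame phi y)].

Definition quaternionic_automorphism (M : manifold R (4 * n))
    (B : almost_quaternionic M) (f : M -> M) :=
  diffeomorphism f /\
  forall x F, B x F <-> B (f x) (F *m tangent_map f x).

End QuaternionicManifold.

Section LieGroup.
Variables (R : realType) (d : nat).

Record lie_group := LieGroup {
  lg_mf :> manifold R d;
  lg_one : lg_mf;
  lg_mul : lg_mf -> lg_mf -> lg_mf;
  lg_inv : lg_mf -> lg_mf;
  lg_mulA : associative lg_mul;
  lg_mul1 : left_id lg_one lg_mul;
  lg_mulV : left_inverse lg_one lg_inv lg_mul;
  lg_mul_smooth : smooth_map (prod_atlas (atlas (m := lg_mf)) (atlas (m := lg_mf)))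
    (atlas (m := lg_mf)) (fun p => lg_mul p.1 p.2);
  lg_inv_smooth : smooth_map (atlas (m := lg_mf)) (atlas (m := lg_mf)) lg_inv }.

(* T_1G, with the bracket defined below. *)
Definition lie_algebra (G : lie_group) : vectType R := 'rV[R]_d.

Variable G : lie_group.

(* The left-invariant vector field of value v at 1, in the chart around 1. *)
Definition left_invariant (v : lie_algebra G) (a : 'rV[R]_d) : 'rV[R]_d :=
  let phi := chart_at (lg_one G) in
  'D_v (fun b => phi (lg_mul (chart_inv phi a) (chart_inv phi b))) (phi (lg_one G)).

(* Value at 1 of the bracket [X,Y] = DY(X) - DX(Y) of left-invariant fields. *)
Definition lie_bracket (v w : lie_algebra G) : lie_algebra G :=
  let X := left_invariant v in
  let Y := left_invariant w in
  let e := chart_at (lg_one G) (lg_one G) in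
  'D_(X e) Y e - 'D_(Y e) X e.

Definition smooth_action d' (M : manifold R d') (act : G -> M -> M) :=
  [/\ forall x, act (lg_one G) x = x,
      forall g h x, act (lg_mul g h) x = act g (act h x) &
      smooth_map (prod_atlas (atlas (m := G)) (atlas (m := M))) (atlas (m := M))
        (fun p => act p.1 p.2)].

End LieGroup.

Arguments lie_bracket {R d} G v w.

Section Complexification.
Variables (R : realType) (g : lmodType R).

(* The pair (x, y) stands for x (x) 1 + y (x) 'i in g (x)_R C. *)
Definition complexification : Type := (g * g)%type.
HB.instance Definition _ := GRing.Zmodule.on complexification.

Definition scaleC (c : R[i]) (u : complexification) : complexification :=
  (complex.Re c *: u.1 - complex.Im c *: u.2, complex.Re c *: u.2 + complex.Im c *: u.1).

Lemma scaleCA a b u : scaleC a (scaleC b u) = scaleC (a * b) u.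
Proof.
case: a b u => [a a'] [b b'] [x y]; rewrite /scaleC /=.
rewrite !(scalerBr, scalerDr, scalerBl, scalerDl) !scalerA !opprD !addrA.
by congr (_, _); rewrite -!addrA; congr (_ + _); rewrite addrA [RHS]addrC ?addrA.
Qed.
Lemma scaleC1 : left_id 1 scaleC.
Proof. by case=> x y; rewrite /scaleC /= !scale1r !scale0r subr0 addr0. Qed.
Lemma scaleCDr : right_distributive scaleC +%R.
Proof.
move=> a [x y] [x' y']; rewrite /scaleC /= !scalerDr opprD.
by congr (_, _); rewrite /= addrACA.
Qed.
Lemma scaleCDl u : {morph scaleC^~ u : a b / a + b}.
Proof.
case: u => [x y] [a a'] [b b']; rewrite /scaleC /= !scalerDl opprD.
by congr (_, _); rewrite /= addrACA.
Qed.
HB.instance Definition _ := GRing.Zmodule_isLmodule.Build R[i] complexification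
  scaleCA scaleC1 scaleCDr scaleCDl.

Definition of_real (x : g) : complexification := (x, 0).

(* The complex bilinear extension of a bracket. *)
Definition bracketC (br : g -> g -> g) (u v : complexification) : complexification :=
  (br u.1 v.1 - br u.2 v.2, br u.1 v.2 + br u.2 v.1).

End Complexification.

Section Representations.
Variable R : realType.

Definition is_real_rep (g : lmodType R) (br : g -> g -> g) (V : vectType R[i])
    (rho : g -> 'End(V)) :=
  (forall (a : R) x y, rho (a *: x + y) = a%:C *: rho x + rho y) /\
  (forall x y, rho (br x y) = ((rho x \o rho y) - (rho y \o rho x))%VF).

Definition is_complex_rep (h : lmodType R[i]) (br : h -> h -> h) (V : vectType R[i])
    (rho : h -> 'End(V)) :=
  (forall (a : R[i]) x y, rho (a *: x + y) = a *: rho x + rho y) /\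
  (forall x y, rho (br x y) = ((rho x \o rho y) - (rho y \o rho x))%VF).

Definition quaternionic_rep (g : lmodType R) (br : g -> g -> g) (V : vectType R[i])
    (rho : g -> 'End(V)) :=
  is_real_rep br rho /\
  exists J : V -> V,
    [/\ forall (c : R[i]) u v, J (c *: u + v) = conjc c *: J u + J v,
        forall v, J (J v) = - v &
        forall x v, J (rho x v) = rho x (J v)].

Definition g_quaternionic (g : lmodType R) (br : g -> g -> g) (V : vectType R[i])
    (rho : complexification g -> 'End(V)) :=
  is_complex_rep (bracketC br) rho /\
  quaternionic_rep br (fun x => rho (of_real x)).

Definition nontrivial_rep (T : Type) (V : vectType R[i]) (rho : T -> 'End(V)) :=
  exists x, rho x <> 0.

Definition is_rho_min (g : lmodType R) (br : g -> g -> g) (V : vectType R[i])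
    (rho : complexification g -> 'End(V)) :=
  [/\ g_quaternionic br rho, nontrivial_rep rho &
      forall (V' : vectType R[i]) (rho' : complexification g -> 'End(V')),
        g_quaternionic br rho' -> nontrivial_rep rho' ->
        (\dim {:V} <= \dim {:V'})%N].

Definition real_dim (V : vectType R[i]) : nat := (2 * \dim {:V})%N.

End Representations.

(* Main.v *)
(* Kulkarni's theorem, infinitesimally: in an integrable chart (an open piece of
   H^n, seen as an affine chart of HP^n) every fundamental field X of the action
   has its derivative in gl(n,H) + H at each point. The first prolongation of
   gl(n,H) + H consists of the forms (h,k) |-> h c(k) + k c(h), c in the dual of
   H^n, and the second one vanishes, so X is the quadratic field
   b + A h + h q + h c h, that is, the field induced on HP^n by a quaternionic
   (n+1)x(n+1) matrix, unique once its trace has zero real part. This turns the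
   Lie algebra of G into matrices acting on H^(n+1), a complex vector space of
   dimension 2n+2 on which right multiplication by j is the required antilinear
   map. The representation is nonzero at a suitable point, for if all fundamental
   fields vanished, all orbit maps would be locally constant and the identity
   component would act trivially. *)
Require Import Defs.
From HB Require Import structures.
From mathcomp Require Import all_boot all_order all_algebra.
From mathcomp Require Import all_classical all_reals all_analysis.
From mathcomp Require Import complex ring lra.

Set Implicit Arguments.
Unset Strict Implicit.
Unset Printing Implicit Defensive.

Import Order.TTheory GRing.Theory Num.Theory.
Import numFieldNormedType.Exports.

Local Open Scope classical_set_scope.
Local Open Scope ring_scope.

(** * Quaternions and the prolongations of gl(n,H) + H *)

(** The obstacle is that [GLnH_Hstar] supplies [A] and [q] separately for each matrix, with no
    smoothness in the point or the group element, so the pair cannot be differentiated. Both the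
    group and its Lie algebra are therefore described without existential quantifiers: the group by
    a polynomial identity in the entries of the Jacobian, the Lie algebra by the linear condition
    [gl_plus_H], whose correction term is read off at one entry of one basis vector. Differentiating
    the first at the identity gives the second, and the second, having constant coefficients, is
    inherited by all derivatives of a field. After that the argument is algebra over H.
    Noncommutativity is used where one might expect room in the dimension, so n = 1 (conformal
    geometry of R^4) needs no separate treatment. Signs agree: fundamental fields of a left action
    reverse brackets, and so do the fields induced by matrices on the projective space. *)

Section QuaternionCoordinates.
Variable R : realType.
Implicit Types (x y : quat R) (r : R).

Lemma quatP x y : q0 x = q0 y -> q1 x = q1 y -> q2 x = q2 y -> q3 x = q3 y -> x = y.
Proof. by case: x => ? ? ? ?; case: y => ? ? ? ? /= -> -> -> ->. Qed.

Lemma q0D x y : q0 (x + y) = q0 x + q0 y. Proof. by []. Qed.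
Lemma q1D x y : q1 (x + y) = q1 x + q1 y. Proof. by []. Qed.
Lemma q2D x y : q2 (x + y) = q2 x + q2 y. Proof. by []. Qed.
Lemma q3D x y : q3 (x + y) = q3 x + q3 y. Proof. by []. Qed.
Lemma q0N x : q0 (- x) = - q0 x. Proof. by []. Qed.
Lemma q1N x : q1 (- x) = - q1 x. Proof. by []. Qed.
Lemma q2N x : q2 (- x) = - q2 x. Proof. by []. Qed.
Lemma q3N x : q3 (- x) = - q3 x. Proof. by []. Qed.
Lemma q0M x y : q0 (x * y) = q0 x * q0 y - q1 x * q1 y - q2 x * q2 y - q3 x * q3 y.
Proof. by []. Qed.
Lemma q1M x y : q1 (x * y) = q0 x * q1 y + q1 x * q0 y + q2 x * q3 y - q3 x * q2 y.
Proof. by []. Qed.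
Lemma q2M x y : q2 (x * y) = q0 x * q2 y - q1 x * q3 y + q2 x * q0 y + q3 x * q1 y.
Proof. by []. Qed.
Lemma q3M x y : q3 (x * y) = q0 x * q3 y + q1 x * q2 y - q2 x * q1 y + q3 x * q0 y.
Proof. by []. Qed.
Lemma q0_0 : q0 (0 : quat R) = 0. Proof. by []. Qed.
Lemma q1_0 : q1 (0 : quat R) = 0. Proof. by []. Qed.
Lemma q2_0 : q2 (0 : quat R) = 0. Proof. by []. Qed.
Lemma q3_0 : q3 (0 : quat R) = 0. Proof. by []. Qed.
Lemma q0_1 : q0 (1 : quat R) = 1. Proof. by []. Qed.
Lemma q1_1 : q1 (1 : quat R) = 0. Proof. by []. Qed.
Lemma q2_1 : q2 (1 : quat R) = 0. Proof. by []. Qed.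
Lemma q3_1 : q3 (1 : quat R) = 0. Proof. by []. Qed.
Definition q0E := (q0D, q0N, q0M, q0_0, q0_1).
Definition q1E := (q1D, q1N, q1M, q1_0, q1_1).
Definition q2E := (q2D, q2N, q2M, q2_0, q2_1).
Definition q3E := (q3D, q3N, q3M, q3_0, q3_1).
Definition qE := (q0E, q1E, q2E, q3E).

End QuaternionCoordinates.

Ltac quat := apply: quatP; rewrite ?qE /=.

Section Quaternions.
Variable R : realType.
Implicit Types (x y : quat R) (r : R).

Definition realq r : quat R := Quat r 0 0 0.
Definition qi : quat R := Quat 0 1 0 0.
Definition qj : quat R := Quat 0 0 1 0.
Definition qk : quat R := Quat 0 0 0 1.
Definition conjq x : quat R := Quat (q0 x) (- q1 x) (- q2 x) (- q3 x).

Lemma realqC r x : realq r * x = x * realq r.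
Proof. by quat; ring. Qed.
Lemma realqD r s : realq (r + s) = realq r + realq s.
Proof. by quat; rewrite ?addr0. Qed.
Lemma realqM r s : realq (r * s) = realq r * realq s.
Proof. by quat; ring. Qed.
Lemma realq1 : realq 1 = 1. Proof. by []. Qed.
Lemma realqN1 : realq (-1) = -1. Proof. by quat; rewrite ?oppr0. Qed.

Lemma quat_basis x : x = realq (q0 x) + qi * realq (q1 x) + qj * realq (q2 x) + qk * realq (q3 x).
Proof. by quat; ring. Qed.

Lemma conjq_mul x : conjq x * x = realq (q0 x ^+ 2 + q1 x ^+ 2 + q2 x ^+ 2 + q3 x ^+ 2).
Proof. by quat; ring. Qed.

Lemma sqrq_eq0 x : q0 x ^+ 2 + q1 x ^+ 2 + q2 x ^+ 2 + q3 x ^+ 2 = 0 -> x = 0.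
Proof.
move=> /eqP; rewrite !paddr_eq0 ?addr_ge0 ?sqr_ge0// !sqrf_eq0.
by move=> /andP[/andP[/andP[/eqP a /eqP b] /eqP c] /eqP d]; apply: quatP.
Qed.

Lemma realq_eq0 r x : r != 0 -> realq r * x = 0 -> x = 0.
Proof.
move=> r0 /(congr1 (fun z => realq r^-1 * z)).
by rewrite mulrA -realqM mulVf// realq1 mul1r mulr0.
Qed.

Lemma mulq_eq0 x y : x != 0 -> x * y = 0 -> y = 0.
Proof.
move=> x0 /(congr1 (fun z => conjq x * z)); rewrite mulrA conjq_mul mulr0.
apply: realq_eq0; apply: contra_neq x0; exact: sqrq_eq0.
Qed.

(* i, j and k generate H over R, so commuting with i and j suffices. *)
Lemma central_real x : qi * x = x * qi -> qj * x = x * qj -> x = realq (q0 x).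
Proof.
move=> hi hj.
have := congr1 (@q2 R) hi; have := congr1 (@q3 R) hi; have := congr1 (@q3 R) hj.
have := congr1 (@q1 R) hj; rewrite !qE /= => h1 h2 h3 h4.
by apply: quatP => //=; lra.
Qed.

End Quaternions.

(** Right multiplication by a quaternion is a product with a 1 x 1 matrix, so that its commutation
    with left multiplication by matrices is just [mulmxA]. *)
Notation "h *q a" := (h *m a%:M) (at level 40, left associativity).

(** * Derivations of H and real-linear maps in gl(n,H) + H *)

Section Derivations.
Variable R : realType.

Lemma anticomm_qi (x : quat R) : x * qi R + qi R * x = 0 -> q0 x = 0 /\ q1 x = 0.
Proof.
move=> E; have := congr1 (@q0 R) E; have := congr1 (@q1 R) E.
by rewrite !qE /=; split; lra.
Qed.

Lemma anticomm_qj (x : quat R) : x * qj R + qj R * x = 0 -> q0 x = 0 /\ q2 x = 0.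
Proof.
move=> E; have := congr1 (@q0 R) E; have := congr1 (@q2 R) E.
by rewrite !qE /=; split; lra.
Qed.

(** [I], [J], [K] stand for the values of a derivation at i, j, k; their shape is what the Leibniz
    rule on the squares of i, j and k imposes. *)
Lemma inner_coords (s t u : R) (a : quat R) :
  let I := Quat 0 0 s t in let J := Quat 0 (- s) 0 u in
  let K := I * qj R + qi R * J in
  let q := realq 4^-1 * (I * qi R + J * qj R + K * qk R) in
  I * realq (q1 a) + J * realq (q2 a) + K * realq (q3 a) = a * q - q * a.
Proof.
move=> I J K q.
have KE : K = Quat 0 (- t) (- u) 0 by rewrite /K /I /J; quat; ring.
have Ii : I * qi R = Quat 0 0 t (- s) by rewrite /I; quat; ring.
have Jj : J * qj R = Quat 0 (- u) 0 (- s) by rewrite /J; quat; ring.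
have Kk : K * qk R = Quat 0 (- u) t 0 by rewrite KE; quat; ring.
have -> : q = Quat 0 (- u / 2) (t / 2) (- s / 2).
  by rewrite /q Ii Jj Kk; quat; field.
by rewrite KE /I /J; case: a => a0 a1 a2 a3; quat; field.
Qed.

End Derivations.

Section RightScaling.
Variables (R : realType) (n : nat) (i0 : 'I_n).
Notation H := (quat R).
Notation V := 'cV[quat R]_n.
Notation e := (delta_mx i0 0 : V).
Implicit Types (h k l : V) (a b : H) (D : V -> V).

Lemma rscalE m (h : 'cV[H]_m) a i : (h *q a) i 0 = h i 0 * a.
Proof. by rewrite !mxE big_ord1 !mxE eqxx mulr1n. Qed.

Lemma rscalA m (h : 'cV[H]_m) a b : h *q a *q b = h *q (a * b).
Proof. by rewrite -mulmxA -scalar_mxM. Qed.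

Lemma rscalDr m (h : 'cV[H]_m) a b : h *q (a + b) = h *q a + h *q b.
Proof. by rewrite raddfD /= mulmxDr. Qed.

Lemma rscalNr m (h : 'cV[H]_m) a : h *q (- a) = - (h *q a).
Proof. by rewrite raddfN /= mulmxN. Qed.

Lemma rscalBr m (h : 'cV[H]_m) a b : h *q (a - b) = h *q a - h *q b.
Proof. by rewrite rscalDr rscalNr. Qed.

Lemma rscal0 m (h : 'cV[H]_m) : h *q 0 = 0.
Proof. by rewrite raddf0 mulmx0. Qed.

Lemma rscal1 m (h : 'cV[H]_m) : h *q 1 = h.
Proof. exact: mulmx1. Qed.

Lemma rscal_eq0 m (h : 'cV[H]_m) a : h != 0 -> h *q a = 0 -> a = 0.
Proof.
move=> h0 ha; have [i hi] : exists i, h i 0 != 0.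
  apply/existsP; apply: contra_neqT h0; rewrite negb_exists => /forallP h0.
  by apply/matrixP => i j; rewrite ord1 mxE; have := h0 i; rewrite negbK => /eqP.
by apply: (mulq_eq0 hi); rewrite -rscalE ha mxE.
Qed.

Lemma delta_neq0 : e != 0.
Proof.
by apply/eqP => /matrixP/(_ i0 0)/eqP; rewrite !mxE !eqxx oner_eq0.
Qed.

Lemma rscal_delta_inj : injective (fun a => e *q a).
Proof.
move=> a b /eqP; rewrite -subr_eq0 -rscalBr => /eqP/(rscal_eq0 delta_neq0)/eqP.
by rewrite subr_eq0 => /eqP.
Qed.

Definition real_linear D :=
  (forall h k, D (h + k) = D h + D k) /\
  (forall r h, D (h *q realq r) = D h *q realq r).

(** If the failure of [D] to commute with right multiplication by [a] is right multiplication by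
    some quaternion, evaluating at [e] and taking the entry [i0] recovers that quaternion. *)
Definition defect D a := D (e *q a) i0 0 - D e i0 0 * a.

(* D lies in gl(n,H) + H, as a closed linear condition on D: the failure of D
   to commute with right multiplication by a is itself a right multiplication. *)
Definition gl_plus_H D := forall h a, D (h *q a) = D h *q a + h *q defect D a.

(** For purely imaginary q one has i q i + j q j + k q k = q. If the defect is a |-> a q - q a, the
    sum in the bracket is therefore q + 3 q, hence the factor 1/4. *)
Definition rotpart D : H := realq 4^-1 *
  (defect D (qi R) * qi R + defect D (qj R) * qj R + defect D (qk R) * qk R).

(** Expanding [D] at [e *q (a * b)] in one step and in two steps, then cancelling the common term,
    leaves the Leibniz rule. *)
Lemma defectM D a b : gl_plus_H D ->
  defect D (a * b) = defect D a * b + a * defect D b.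
Proof.
move=> hD; apply: rscal_delta_inj => /=.
have := hD e (a * b); rewrite -rscalA hD hD mulmxDl !rscalA.
by rewrite -addrA => /addrI <-; rewrite rscalDr.
Qed.

Lemma defectD D a b : real_linear D -> defect D (a + b) = defect D a + defect D b.
Proof.
by case=> DD _; rewrite /defect rscalDr DD mxE mulrDr opprD addrACA.
Qed.

Lemma defect_real D a r : real_linear D -> defect D (a * realq r) = defect D a * realq r.
Proof.
by case=> _ DZ; rewrite /defect -rscalA DZ rscalE mulrA -mulrBl.
Qed.

(* By defectM the defect is a derivation of H, hence inner; averaging over i, j, k
   gives the explicit rotpart. *)
Lemma defect_inner D a : real_linear D -> gl_plus_H D ->
  defect D a = a * rotpart D - rotpart D * a.
Proof.
move=> Dl Dh.
have d1 : defect D 1 = 0 by rewrite /defect rscal1 mulr1 subrr.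
have dr r : defect D (realq r) = 0.
  by rewrite -(mul1r (realq r)) defect_real// d1 mul0r.
have dN1 : defect D (-1) = 0 by rewrite -realqN1 dr.
pose I := defect D (qi R); pose J := defect D (qj R); pose K := defect D (qk R).
have eI : I * qi R + qi R * I = 0.
  rewrite -(defectM _ _ Dh) -[RHS]dN1; congr defect; by quat; ring.
have eJ : J * qj R + qj R * J = 0.
  rewrite -(defectM _ _ Dh) -[RHS]dN1; congr defect; by quat; ring.
have eK : K = I * qj R + qi R * J.
  rewrite -(defectM _ _ Dh); congr defect; by quat; ring.
(* The square of k being -1 removes the real part of [K], which ties the i-coordinate of [J] to the
   j-coordinate of [I]. Three free parameters remain, the dimension of the imaginary quaternions. *)
have eK' : q0 K = 0.
  have : K * qk R + qk R * K = 0.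
    rewrite -(defectM _ _ Dh) -[RHS]dN1; congr defect; by quat; ring.
  by move=> /(congr1 (@q3 R)); rewrite !qE /=; lra.
rewrite {1}(quat_basis a) !defectD// !defect_real// dr add0r /rotpart -/I -/J -/K eK.
have [I0 I1] := anticomm_qi eI; have [J0 J2] := anticomm_qj eJ.
have JI : q1 J = - q2 I by move: eK'; rewrite eK !qE /=; lra.
have -> : I = Quat 0 0 (q2 I) (q3 I) by apply: quatP.
have -> : J = Quat 0 (- q2 I) 0 (q3 J) by apply: quatP.
exact: inner_coords.
Qed.

Lemma gl_plus_HE D h a : real_linear D -> gl_plus_H D ->
  D (h *q a) = D h *q a + h *q (a * rotpart D - rotpart D * a).
Proof. by move=> Dl Dh; rewrite Dh defect_inner. Qed.

Lemma rotpartD D D' : rotpart (D \+ D') = rotpart D + rotpart D'.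
Proof.
have dD a : defect (D \+ D') a = defect D a + defect D' a.
  by rewrite /defect /= !mxE mulrDl opprD addrACA.
rewrite /rotpart !dD -mulrDr; congr (_ * _); move: (defect D) (defect D') => d d'.
by rewrite !mulrDl [X in X + _]addrACA [LHS]addrACA.
Qed.

Lemma rotpartZ D r : rotpart (fun h => D h *q realq r) = rotpart D * realq r.
Proof.
have dZ a : defect (fun h => D h *q realq r) a = defect D a * realq r.
  by rewrite /defect !rscalE mulrBl -!mulrA (realqC r a).
have mC x y : x * realq r * y = x * y * realq r :> H by rewrite -!mulrA realqC.
by rewrite /rotpart !dZ !mC -!mulrDl mulrA.
Qed.

End RightScaling.

Section Commutators.
Variable R : realType.
Implicit Types x y : quat R.

(** A commutator with i forgets the real and i-coordinates, so only two coordinates of [y] are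
    determined; the lemmas for j and k supply others. *)
Lemma comm_qi x y : (qi R * x - x * qi R) * qi R = qi R * y - y * qi R ->
  q2 y = q3 x /\ q3 y = - q2 x.
Proof.
move=> E; have := congr1 (@q2 R) E; have := congr1 (@q3 R) E.
by rewrite !qE /=; split; lra.
Qed.

Lemma comm_qj x y : (qj R * x - x * qj R) * qj R = qj R * y - y * qj R ->
  q3 y = q1 x /\ q1 y = - q3 x.
Proof.
move=> E; have := congr1 (@q1 R) E; have := congr1 (@q3 R) E.
by rewrite !qE /=; split; lra.
Qed.

Lemma comm_qk x y : (qk R * x - x * qk R) * qk R = qk R * y - y * qk R ->
  q1 y = q2 x /\ q2 y = - q1 x.
Proof.
move=> E; have := congr1 (@q1 R) E; have := congr1 (@q2 R) E.
by rewrite !qE /=; split; lra.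
Qed.

Lemma comm_im r x y : y * x - x * y =
  y * Quat r (q1 x) (q2 x) (q3 x) - Quat r (q1 x) (q2 x) (q3 x) * y.
Proof. by quat; ring. Qed.

End Commutators.

(** * The first and second prolongations *)

Section FirstProlongation.
Variables (R : realType) (n : nat) (i0 : 'I_n).
Notation H := (quat R).
Notation V := 'cV[quat R]_n.
Notation e := (delta_mx i0 0 : V).
Implicit Types (h k l : V) (a b : H) (D : V -> V).

(** On the line of [e] the relation reads u (e a) = a u(e). Comparing e i with e j gives (ij - ji)
    u(e) = 0, so noncommutativity alone kills u(e), even when n = 1. *)
Lemma antisym_rscal_eq0 (u : V -> H) :
  (forall h k, h *q u k = k *q u h) -> forall k, u k = 0.
Proof.
move=> hu; have ue a : u (e *q a) = a * u e.
  by apply: (@rscal_delta_inj R n i0) => /=; rewrite hu rscalA.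
have u0 : u e = 0.
  have := hu (e *q qi R) (e *q qj R); rewrite !ue !rscalA => /(@rscal_delta_inj R n i0).
  move: (u e) => g E; apply: (@mulq_eq0 R (qk R *+ 2)).
    by apply/eqP => /(congr1 (@q3 R)); rewrite mulr2n !qE /=; lra.
  have -> : qk R *+ 2 = qi R * qj R - qj R * qi R.
    by rewrite mulr2n; quat; ring.
  by rewrite mulrBl -!mulrA E subrr.
by move=> k; apply: (rscal_eq0 (delta_neq0 R i0)); rewrite hu u0 rscal0.
Qed.

Lemma col_basis h : h = \sum_j (delta_mx j 0 : V) *q h j 0.
Proof.
apply/matrixP => i j; rewrite ord1 summxE (bigD1 i)//= rscalE !mxE !eqxx mul1r.
rewrite big1 ?addr0// => l li; rewrite rscalE !mxE eq_sym (negbTE li) mul0r//.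
Qed.

Lemma semilinear_row (c : V -> H) :
  (forall h k, c (h + k) = c h + c k) ->
  (forall h a, c (h *q a) = c h * a) ->
  forall h, (c h)%:M = (\row_j c (delta_mx j 0)) *m h :> 'M[H]_1.
Proof.
move=> cD cZ h; apply/matrixP => i j; rewrite !ord1 !mxE eqxx mulr1n.
have c0 : c 0 = 0 by rewrite -(rscal0 0) cZ mulr0.
rewrite {1}(col_basis h) (big_morph c cD c0); apply: eq_bigr => l _.
by rewrite cZ mxE.
Qed.

(** The form [c] is built from the rotation parts [q h] of the maps [beta h]. Commutators see only
    their imaginary parts, so the real part may be chosen to make [c] quaternion-linear; the
    remainder is then bilinear over H, which forces it to vanish. *)
Lemma first_prolongation (beta : V -> V -> V) :
  (forall h k, beta h k = beta k h) -> (forall h, real_linear (beta h)) ->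
  (forall h, gl_plus_H i0 (beta h)) ->
  exists c : 'rV[H]_n, forall h k, beta h k = h *m (c *m k) + k *m (c *m h).
Proof.
move=> bC bl bH.
have [q [bE qD qZ]] : exists q : V -> H,
    [/\ forall h k a, beta h (k *q a) = beta h k *q a + k *q (a * q h - q h * a),
        forall h k, q (h + k) = q h + q k &
        forall h r, q (h *q realq r) = q h * realq r].
  exists (fun h => rotpart i0 (beta h)); split=> [h k a|h k|h r].
  - exact: gl_plus_HE.
  - rewrite -rotpartD; congr rotpart; apply/funext => l /=.
    by rewrite bC (bl l).1 !(bC l).
  - rewrite -rotpartZ; congr rotpart; apply/funext => l /=.
    by rewrite bC (bl l).2 (bC l).
(* Symmetry allows [beta (h *q a) (k *q a)] to be expanded with either argument first. The
   difference has the form required by [antisym_rscal_eq0]. *)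
have u0 a k : (a * q k - q k * a) * a = a * q (k *q a) - q (k *q a) * a.
  apply/eqP; rewrite -subr_eq0; apply/eqP; move: k.
  apply: antisym_rscal_eq0 => h k.
  have E1 : beta (h *q a) (k *q a) = beta h k *q a *q a +
      h *q ((a * q k - q k * a) * a) + k *q (a * q (h *q a) - q (h *q a) * a).
    by rewrite bE (bC (h *q a)) bE (bC k) mulmxDl !rscalA.
  have E2 : beta (h *q a) (k *q a) = beta h k *q a *q a +
      k *q ((a * q h - q h * a) * a) + h *q (a * q (k *q a) - q (k *q a) * a).
    by rewrite bC bE (bC (k *q a)) bE mulmxDl !rscalA.
  have := etrans (esym E1) E2; rewrite -!addrA => /addrI E.
  rewrite !rscalBr; apply/eqP; rewrite subr_eq addrAC eq_sym subr_eq; apply/eqP.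
  by rewrite -!rscalBr E addrC.
(* The real part of c(h) is the i-coordinate of c(h) i, so requiring c(h i) = c(h) i leaves this
   choice only. *)
pose c h := Quat (q1 (q (h *q qi R))) (q1 (q h)) (q2 (q h)) (q3 (q h)).
have crot h a : a * q h - q h * a = a * c h - c h * a.
  exact: comm_im.
have cD h k : c (h + k) = c h + c k by rewrite /c mulmxDl !qD; quat.
have cr h r : c (h *q realq r) = c h * realq r.
  by rewrite /c rscalA (realqC r (qi R)) -rscalA !qZ; quat; ring.
have ci h : c (h *q qi R) = c h * qi R.
  have [E2 E3] := comm_qi (u0 (qi R) h).
  have E1 : q1 (q (h *q qi R *q qi R)) = - q1 (q h).
    have -> : h *q qi R *q qi R = h *q realq (-1).
      by rewrite rscalA; congr (_ *q _); quat; ring.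
    by rewrite qZ !qE /=; ring.
  by rewrite /c; quat; rewrite ?E1 ?E2 ?E3; ring.
have cj h : c (h *q qj R) = c h * qj R.
  have [E3 E1] := comm_qj (u0 (qj R) h).
  (* The real part was defined through i; linearity for j needs the same value through j. The two
     are compared by writing i = j k. *)
  have E2 : q2 (q (h *q qj R)) = q1 (q (h *q qi R)).
    have [<- _] := comm_qk (u0 (qk R) (h *q qj R)).
    by rewrite rscalA; congr (q1 (q (_ *q _))); quat; ring.
  have E0 : q1 (q (h *q qj R *q qi R)) = - q2 (q h).
    have [<- _] := comm_qk (u0 (qk R) h).
    have -> : h *q qj R *q qi R = h *q qk R *q realq (-1).
      by rewrite !rscalA; congr (_ *q _); quat; ring.
    by rewrite qZ !qE /=; ring.
  by rewrite /c; quat; rewrite ?E0 ?E1 ?E2 ?E3; ring.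
have ck h : c (h *q qk R) = c h * qk R.
  have -> : qk R = qi R * qj R by quat; ring.
  by rewrite -rscalA cj ci mulrA.
have cZ h a : c (h *q a) = c h * a.
  rewrite (quat_basis a) !rscalDr !cD -!rscalA !cr ci cj ck.
  by rewrite !mulrDr !mulrA.
have cE := semilinear_row cD cZ.
exists (\row_j c (delta_mx j 0)) => h k; rewrite -!cE.
apply/eqP; rewrite -subr_eq0; apply/eqP.
(* A symmetric map that is right linear over H in one argument is so in both; pulling i and j out in
   the two possible orders gives g (ij) = g (ji), hence g = 0. *)
pose g h k := beta h k - (h *q c k + k *q c h).
have gC h' k' : g h' k' = g k' h' by rewrite /g bC [X in _ - X]addrC.
have gZ h' k' a : g h' (k' *q a) = g h' k' *q a.
  rewrite /g bE cZ mulmxBl mulmxDl !rscalA crot rscalBr.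
  rewrite -[LHS]addrA; congr (_ + _).
  by rewrite [h' *q _ + _]addrC opprD addrACA subrr add0r -opprD addrC.
rewrite -/(g h k); apply/eqP; apply: contraT => gn0.
have E : g h k *q (qi R * qj R) = g h k *q (qj R * qi R).
  rewrite -[LHS]rscalA -[g h k *q qi R]gZ [g h _]gC -[LHS]gZ [LHS]gC gZ.
  by rewrite [g _ k]gC gZ [g k h]gC rscalA.
have := rscal_eq0 gn0 (_ : g h k *q (qi R * qj R - qj R * qi R) = 0).
rewrite rscalBr E subrr => /(_ erefl)/(congr1 (@q3 R)).
by rewrite !qE /=; lra.
Qed.
End FirstProlongation.

Section SecondProlongation.
Variables (R : realType) (n : nat) (i0 : 'I_n).
Notation H := (quat R).
Notation V := 'cV[quat R]_n.
Implicit Types (h k l w : V) (a b d : H).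

(** The second prolongation restricted to one line w H: [g] is s(w,w) and [s a] is s(w a, w).
    Setting b = 1 expresses [s] by [g]; commutators with [g] then turn out central, so [g] is real
    and s a = a g. *)
Lemma triple_symmetric_eq0 (g : H) (s : H -> H) :
  (forall a b, a * g * b + b * g * a = s a * b + b * s a) ->
  (forall a b d, b * s a * d + d * s a * b = a * s b * d + d * s b * a) ->
  g = 0.
Proof.
move=> E1 E2.
have s2 a : s a + s a = a * g + g * a.
  by have := E1 a 1; rewrite !mulr1 !mul1r => ->.
have E3 a b : (a * g - g * a) * b = b * (a * g - g * a).
  have E : a * g * b + b * g * a + (a * g * b + b * g * a)
      = (a * g + g * a) * b + b * (a * g + g * a).
    by rewrite E1 -s2 mulrDl mulrDr addrACA.
  move: E; rewrite mulrDl mulrDr mulrBl mulrBr !mulrA.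
  move: (a * g * b) (b * g * a) (g * a * b) (b * a * g) => x y z t E.
  have {}E : x + y = z + t.
    by apply: (addrI (x + y)); rewrite E [t + y]addrC addrACA.
  by apply/eqP; rewrite subr_eq addrAC eq_sym subr_eq addrC -E addrC.
have g2 : q2 g = 0.
  by have := congr1 (@q1 R) (E3 (qi R) (qj R)); rewrite !qE /=; lra.
have g3 : q3 g = 0.
  by have := congr1 (@q1 R) (E3 (qi R) (qk R)); rewrite !qE /=; lra.
have g1 : q1 g = 0.
  by have := congr1 (@q2 R) (E3 (qj R) (qi R)); rewrite !qE /=; lra.
have gE : g = realq (q0 g) by apply: quatP.
have sE a : s a = a * realq (q0 g).
  have := s2 a; rewrite gE (realqC _ a) => E.
  apply: quatP; [move: (congr1 (@q0 R) E)|move: (congr1 (@q1 R) E)|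
    move: (congr1 (@q2 R) E)|move: (congr1 (@q3 R) E)]; rewrite !qE /=; lra.
(* For real g the two sides of [E2] at i, j, i are -2 g j and 2 g j, because i j i = j. *)
have := congr1 (@q2 R) (E2 (qi R) (qj R) (qi R)); rewrite !sE !qE /= => E.
by rewrite gE; apply: quatP => //=; lra.
Qed.

(** Each [T l] lies in the first prolongation, with a form [s l]; the remaining symmetry, between
    [l] and [h], relates forms with different [l] and kills first s(w,w), then s(w,k). *)
Lemma second_prolongation (T : V -> V -> V -> V) :
  (forall l h k, T l h k = T h l k) -> (forall l h k, T l h k = T l k h) ->
  (forall l h, real_linear (T l h)) -> (forall l h, gl_plus_H i0 (T l h)) ->
  forall l h k, T l h k = 0.
Proof.
move=> T12 T23 Tl TH.
have [s [sE sZ]] : exists s : V -> V -> H,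
    (forall l h k, T l h k = h *q s l k + k *q s l h) /\
    (forall l h a, s l (h *q a) = s l h * a).
  have C l : exists c : 'rV[H]_n,
      forall h k, T l h k = h *m (c *m k) + k *m (c *m h).
    by apply: first_prolongation.
  exists (fun l k => (sval (cid (C l)) *m k) 0 0); split=> l h k.
    by rewrite (svalP (cid (C l)) h k); congr (_ + _); congr (_ *m _); exact: mx11_scalar.
  by rewrite mulmxA rscalE.
have s0 l : s l 0 = 0 by rewrite -(rscal0 0) sZ mulr0.
have sww w : s w w = 0.
  have [->|w0] := eqVneq w 0; first exact: s0.
  have wI : injective (fun a => w *q a).
    move=> a b /eqP; rewrite -subr_eq0 -rscalBr => /eqP/(rscal_eq0 w0)/eqP.
    by rewrite subr_eq0 => /eqP.
  apply: (@triple_symmetric_eq0 _ (fun a => s (w *q a) w)) => [a b|a b d].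
  - apply: wI => /=; have := T12 w (w *q a) (w *q b).
    by rewrite !sE !sZ !rscalA -!rscalDr !mulrA.
  - apply: wI => /=; have := T12 (w *q a) (w *q b) (w *q d).
    by rewrite !sE !sZ !rscalA -!rscalDr !mulrA.
have s2 w k : w != 0 -> s w k = s k w + s k w.
  move=> w0; apply/eqP; rewrite -subr_eq0; apply/eqP; apply: (rscal_eq0 w0).
  have := T12 w k w; rewrite T23 !sE sww rscal0 addr0 => E.
  by rewrite rscalBr E rscalDr subrr.
(* Using [s2] in both orders gives s(w,k) = 4 s(w,k). *)
have swk w k : w != 0 -> k != 0 -> s w k = 0.
  move=> w0 k0; have := s2 w k w0; rewrite (s2 k w k0) => E.
  have ? : realq 3 * s w k = 0.
    move: E; move: (s w k) => x /eqP; rewrite -subr_eq0 => /eqP E.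
    transitivity (- (x - (x + x + (x + x)))); last by rewrite E oppr0.
    by quat; ring.
  by apply: (@realq_eq0 R 3).
(* The previous steps cancel nonzero vectors, so triples containing 0 are treated apart. *)
move=> l h k; have T0 l' h' : T l' h' 0 = 0.
  by have := (Tl l' h').2 0 0; rewrite -[realq 0]/(0 : H) !rscal0.
have [->|l0] := eqVneq l 0; first by rewrite T12 T23.
have [->|h0] := eqVneq h 0; first by rewrite T23.
have [->|k0] := eqVneq k 0; first by [].
by rewrite sE !swk// !rscal0 addr0.
Qed.
End SecondProlongation.

(** * Projective vector fields and the representation on H^(n+1) *)

Section ProjectiveFields.
Variables (R : realType) (n : nat).
Notation H := (quat R).
Notation V := 'cV[quat R]_n.
Implicit Types (h k : V) (M N : 'M[quat R]_(n + 1)).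

Definition lift_col h : 'M[quat R]_(n + 1, 1) := col_mx h 1%:M.
(** Its kernel is the line spanned by [lift_col h], so it represents the quotient of H^(n+1) by that
    line, which models the tangent space at the point h of HP^n. *)
Definition kill_row h : 'M[quat R]_(n, n + 1) := row_mx 1%:M (- h).

(* In the affine chart h of HP^n, the field generated by the linear map M
   of H^(n+1). *)
Definition proj_field M h : V := kill_row h *m M *m lift_col h.

(** The derivative of [proj_field M] at h in the direction k, written out by the product rule; here
    it is a purely algebraic object. *)
Definition dproj_field M h k : V :=
  row_mx 0 (- k) *m M *m lift_col h + kill_row h *m M *m col_mx k 0.

Lemma kill_lift h : kill_row h *m lift_col h = 0.
Proof. by rewrite mul_row_col mul1mx mulmx1 subrr. Qed.

(** The splitting of H^(n+1) into the line over h and the hyperplane at infinity; inserted between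
    [M] and [N], it breaks up the field of the product. *)
Lemma lift_kill_sum h :
  lift_col h *m row_mx (0 : 'M[H]_(1, n)) 1%:M + col_mx 1%:M 0 *m kill_row h = 1%:M.
Proof.
rewrite !mul_col_row !mulmx0 !mul0mx !mulmx1 !mul1mx add_block_mx.
by rewrite !add0r !addr0 subrr -scalar_mx_block.
Qed.

(** The first two terms trade places when [M] and [N] do, so only the last one survives
    antisymmetrisation. *)
Lemma dproj_fieldM M N h : dproj_field N h (proj_field M h) =
  kill_row h *m N *m col_mx 1%:M 0 *m kill_row h *m M *m lift_col h +
  kill_row h *m M *m col_mx 1%:M 0 *m kill_row h *m N *m lift_col h -
  proj_field (M *m N) h.
Proof.
rewrite /dproj_field.
have -> : row_mx (0 : 'M[H]_n) (- proj_field M h) =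
    - (proj_field M h *m row_mx (0 : 'M[H]_(1, n)) 1%:M).
  by rewrite mul_mx_row mulmx0 mulmx1 opp_row_mx oppr0.
have -> : col_mx (proj_field M h) 0 = (col_mx 1%:M 0 : 'M[H]_(n + 1, n)) *m proj_field M h.
  by rewrite mul_col_mx mul1mx mul0mx.
have E : proj_field (M *m N) h = proj_field M h *m row_mx (0 : 'M[H]_(1, n)) 1%:M *m N *m lift_col h +
    kill_row h *m M *m col_mx 1%:M 0 *m kill_row h *m N *m lift_col h.
  rewrite /proj_field -!mulmxA -mulmxDr -mulmxDr; congr (_ *m (_ *m _)).
  by rewrite !mulmxA -!mulmxDl lift_kill_sum mul1mx.
rewrite E !mulNmx opprD addrACA addrN addr0 addrC; congr (_ + _).
by rewrite /proj_field !mulmxA.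
Qed.

Lemma proj_fieldB M N h : proj_field (M - N) h = proj_field M h - proj_field N h.
Proof. by rewrite /proj_field mulmxBr mulmxBl. Qed.

Lemma proj_fieldD M N h : proj_field (M + N) h = proj_field M h + proj_field N h.
Proof. by rewrite /proj_field mulmxDr mulmxDl. Qed.

(** The order of the two derivatives is that of [fund_bracket], so no sign enters the
    representation. *)
Lemma proj_field_bracket M N h :
  dproj_field M h (proj_field N h) - dproj_field N h (proj_field M h) =
  proj_field (M *m N - N *m M) h.
Proof.
by rewrite !dproj_fieldM proj_fieldB [X in X - _ - _]addrC opprB addrCA addrAC subrr add0r.
Qed.

(** [kill_row h] subtracts h times the lower row, whence the signs on [c] and [q]. *)
Lemma proj_field_block (A : 'M[H]_n) (b : V) (c : 'rV[H]_n) (q : H) h :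
  proj_field (block_mx A b (- c) (- q%:M)) h = b + A *m h + h *q q + h *m (c *m h).
Proof.
rewrite /proj_field -mulmxA mul_block_col mul_row_col mul1mx !mulmx1 !mulNmx.
by rewrite -opprD mulmxN opprK mulmxDr [A *m h + b]addrC addrA addrAC.
Qed.

Lemma dproj_field_block (A : 'M[H]_n) (b : V) (c : 'rV[H]_n) (q : H) h k :
  dproj_field (block_mx A b (- c) (- q%:M)) h k =
  A *m k + k *q q + (h *m (c *m k) + k *m (c *m h)).
Proof.
rewrite /dproj_field -!mulmxA !mul_block_col !mul_row_col !mul1mx !mul0mx add0r.
rewrite !mulmx0 !addr0 !mulmx1 !mulNmx.
rewrite -opprD !mulmxN !opprK mulmxDr.
by rewrite [LHS]addrC [k *m _ + _]addrC addrACA.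
Qed.

Definition real_trace m (M : 'M[H]_m) : R := q0 (\tr M).

Lemma q0_sum I (s : seq I) (F : I -> H) : q0 (\sum_(i <- s) F i) = \sum_(i <- s) q0 (F i).
Proof. exact: (big_morph (@q0 R) (@q0D R) (q0_0 R)). Qed.

(** Over H the trace itself is not cyclic, but Re(xy) = Re(yx). Commutators of matrices thus keep
    the normalisation [real_trace] = 0. *)
Lemma real_traceC m (M N : 'M[H]_m) : real_trace (M *m N) = real_trace (N *m M).
Proof.
rewrite /real_trace /mxtrace !q0_sum.
have E (A B : 'M[H]_m) : \sum_i q0 ((A *m B) i i) = \sum_i \sum_j q0 (A i j * B j i).
  by apply: eq_bigr => i _; rewrite mxE q0_sum.
rewrite !E exchange_big; apply: eq_bigr => i _; apply: eq_bigr => j _.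
by rewrite !q0M; ring.
Qed.

Lemma real_traceD m (M N : 'M[H]_m) : real_trace (M + N) = real_trace M + real_trace N.
Proof. by rewrite /real_trace mxtraceD. Qed.

Lemma real_traceB m (M N : 'M[H]_m) : real_trace (M - N) = real_trace M - real_trace N.
Proof. by rewrite /real_trace raddfB. Qed.

Lemma real_trace_scalar m r : real_trace ((realq r)%:M : 'M[H]_m) = r *+ m.
Proof.
by rewrite /real_trace mxtrace_scalar; elim: m => // m IH; rewrite !mulrSr q0D IH.
Qed.

Lemma real_scalar_comm m p (A : 'M[H]_(m, p)) r : A *m (realq r)%:M = (realq r)%:M *m A.
Proof.
apply/matrixP => i j; rewrite mul_scalar_mx !mxE (bigD1 j)//= !mxE eqxx.
by rewrite big1 ?addr0 ?realqC ?mulr1n// => l /negbTE lj; rewrite !mxE lj mulr0.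
Qed.

(* Real multiples of the identity act trivially on HP^n. *)
Lemma traceless_representative M : exists N, [/\ real_trace N = 0,
  forall h, proj_field M h = proj_field N h &
  forall h k, dproj_field M h k = dproj_field N h k].
Proof.
pose t := real_trace M / (n + 1)%:R; exists (M - (realq t)%:M); split=> [|h|h k].
- by rewrite real_traceB real_trace_scalar -mulr_natr divfK ?subrr.
- rewrite proj_fieldB /proj_field real_scalar_comm -[X in _ - X]mulmxA.
  by rewrite kill_lift mulmx0 subr0.
- have E : row_mx 0 (- k) *m (realq t)%:M *m lift_col h +
      kill_row h *m (realq t)%:M *m col_mx k 0 = 0.
    rewrite real_scalar_comm (real_scalar_comm (kill_row h)) -mulmxA.
    rewrite -[X in _ + X]mulmxA -mulmxDr !mul_row_col mul0mx mulmx1 mul1mx.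
    by rewrite mulmx0 add0r addr0 addNr mulmx0.
  by rewrite /dproj_field !mulmxBr !mulmxBl addrACA -opprD E subr0.
Qed.
End ProjectiveFields.

Section Faithfulness.
Variables (R : realType) (n : nat) (i0 : 'I_n).
Notation H := (quat R).
Notation V := 'cV[quat R]_n.
Implicit Types (h k : V).

Lemma real_rscal_eq0 m (w : 'cV[H]_m) (r : R) : r != 0 -> w *q realq r = 0 -> w = 0.
Proof.
move=> r0 /(congr1 (fun z => z *q realq r^-1)).
by rewrite rscalA -realqM divff// mul0mx rscal1.
Qed.

Lemma scalar_mxN m (a : H) : (- a)%:M = - a%:M :> 'M[H]_m.
Proof. exact: raddfN. Qed.

Lemma realqN (r : R) : realq (- r) = - realq r.
Proof. by apply: quatP; rewrite /= ?oppr0. Qed.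

(** The fields are at most quadratic, so vanishing at 0 and at one pair of opposite nonzero points
    on each real line suffices. The step [r] may depend on [h] because only a ball will be
    available. *)
Lemma proj_field_eq0 (M : 'M[H]_(n + 1)) : real_trace M = 0 ->
  proj_field M 0 = 0 ->
  (forall h, exists r, [/\ r != 0, proj_field M (h *q realq r) = 0 &
     proj_field M (- (h *q realq r)) = 0]) ->
  M = 0.
Proof.
pose A := ulsubmx M; pose b := ursubmx M.
pose c := - dlsubmx M; pose q := - drsubmx M 0 0.
have -> : M = block_mx A b (- c) (- q%:M).
  by rewrite opprK /q scalar_mxN opprK -mx11_scalar submxK.
move: A b c q => A b c q {M} trM; rewrite proj_field_block !mul0mx !mulmx0 !addr0 => b0.
subst b => hM.
(* The values at h r and -h r are L r + Q r^2 and -L r + Q r^2, where L and Q are the linear and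
   quadratic parts at h. *)
have {hM} LQ h : A *m h + h *q q = 0 /\ h *m (c *m h) = 0.
  have [r [r0]] := hM h; rewrite !proj_field_block !add0r.
  have -> : A *m (h *q realq r) = A *m h *q realq r by rewrite mulmxA.
  have -> : h *q realq r *q q = h *q q *q realq r by rewrite !rscalA realqC.
  have -> : h *q realq r *m (c *m (h *q realq r)) = h *m (c *m h) *q realq r *q realq r.
    by rewrite -[LHS]mulmxA -real_scalar_comm !mulmxA.
  have -> : A *m - (h *q realq r) = - (A *m h *q realq r) by rewrite mulmxN mulmxA.
  have -> : - (h *q realq r) *q q = - (h *q q *q realq r).
    by rewrite mulNmx !rscalA realqC.
  have -> : - (h *q realq r) *m (c *m - (h *q realq r)) =
      h *m (c *m h) *q realq r *q realq r.
    by rewrite !mulmxN mulNmx opprK -[LHS]mulmxA -real_scalar_comm !mulmxA.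
  rewrite -opprD -(mulmxDl _ _ (realq r)%:M).
  set L := A *m h + _; set Q := h *m (_ *m _) => E1 E2.
  have Q0 : Q = 0.
    apply: (real_rscal_eq0 r0); apply: (real_rscal_eq0 r0).
    apply: (@real_rscal_eq0 _ _ (1 + 1)); first by rewrite gt_eqF// addr_gt0.
    by rewrite realqD rscalDr !rscal1 -[RHS]addr0 -{1}E1 -E2 addrACA subrr add0r.
  split=> //; apply: (real_rscal_eq0 r0).
  by move: E1; rewrite Q0 !mul0mx addr0.
(* Left multiplication by [A] commutes with right multiplications; since A h = - h q for all h, so
   does right multiplication by [q], which makes [q] central. *)
have qc a : a * q = q * a.
  apply: (@rscal_delta_inj R n i0) => /=; apply: oppr_inj; rewrite -!rscalA.
  have AE h : A *m h = - (h *q q) by apply/eqP; rewrite -addr_eq0 (LQ h).1.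
  by rewrite -AE mulmxA AE mulNmx.
have qr : q = realq (q0 q) by apply: central_real.
have A0 h : A *m h + h *q realq (q0 q) = 0 by rewrite -qr (LQ h).1.
have AE : A = - (realq (q0 q))%:M.
  apply/matrixP => i j; have /matrixP/(_ i 0) := A0 (delta_mx j 0).
  rewrite -colE real_scalar_comm mul_scalar_mx !mxE !eqxx andbT => /eqP.
  by rewrite addr_eq0 mulr_natr => /eqP.
(* The diagonal blocks are now the real scalar - [q0 q], so the real trace is -(n + 1) times
   [q0 q]. *)
have q00 : q0 q = 0.
  move: trM; rewrite {1}/real_trace mxtrace_block q0D AE -[q0 _]/(real_trace _).
  rewrite -[X in _ + X]/(real_trace _) {2}qr -!scalar_mxN -!realqN !real_trace_scalar.
  move=> /eqP; rewrite -mulrnDr mulrn_eq0 addn1 /= oppr_eq0 => /eqP//.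
have c0 : c = 0.
  apply/matrixP => i j; rewrite ord1 !mxE.
  have := (LQ (delta_mx j 0)).2; rewrite -colE [col _ _]mx11_scalar.
  by move=> /(rscal_eq0 (delta_neq0 _ _)); rewrite mxE.
by rewrite AE c0 qr q00 -[realq 0]/(0 : H) !raddf0 ?oppr0 block_mx0.
Qed.
End Faithfulness.

(** * H^m as a complex vector space and its quaternionic representations *)

Section QuaternionicSpace.
Variables (R : realType) (m : nat).
Notation H := (quat R).

Definition toq (c : R[i]) : H := Quat (complex.Re c) (complex.Im c) 0 0.

Lemma toqM a b : toq (a * b) = toq a * toq b.
Proof. by case: a b => [a a'] [b b']; apply: quatP; rewrite ?qE /=; ring. Qed.
Lemma toqD a b : toq (a + b) = toq a + toq b.
Proof. by case: a b => [a a'] [b b']; apply: quatP; rewrite ?qE /= ?addr0. Qed.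
Lemma toqi : toq ('i)%C = qi R. Proof. by []. Qed.
(** This is what makes right multiplication by j antilinear. *)
Lemma toq_conj c : qj R * toq (conjc c) = toq c * qj R.
Proof. by case: c => a b; apply: quatP; rewrite ?qE /=; ring. Qed.

(* H^m as a complex vector space, scalars acting on the right. *)
Definition qspace : Type := 'cV[H]_m.
HB.instance Definition _ := GRing.Zmodule.on qspace.

Definition qscale (c : R[i]) (u : qspace) : qspace := u *q toq c.
Lemma qscaleA a b u : qscale a (qscale b u) = qscale (a * b) u.
Proof. by rewrite /qscale rscalA mulrC toqM. Qed.
Lemma qscale1 : left_id 1 qscale.
Proof. by move=> u; rewrite /qscale rscal1. Qed.
Lemma qscaleDr : right_distributive qscale +%R.
Proof. by move=> a u v; rewrite /qscale mulmxDl. Qed.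
Lemma qscaleDl u : {morph qscale^~ u : a b / a + b}.
Proof. by move=> a b; rewrite /qscale toqD rscalDr. Qed.
HB.instance Definition _ := GRing.Zmodule_isLmodule.Build R[i] qspace
  qscaleA qscale1 qscaleDr qscaleDl.

(* The coordinates z, w of an entry z + j w. *)
Definition qcoord (u : qspace) : 'rV[R[i]]_(m + m) :=
  row_mx (\row_i (q0 (u i 0) +i* q1 (u i 0))%C) (\row_i (q2 (u i 0) -i* q3 (u i 0))%C).
Definition qcoord_inv (v : 'rV[R[i]]_(m + m)) : qspace :=
  \col_i Quat (complex.Re (lsubmx v 0 i)) (complex.Im (lsubmx v 0 i))
    (complex.Re (rsubmx v 0 i)) (- complex.Im (rsubmx v 0 i)).

Lemma qspace_vector : Vector.axiom (m + m) qspace.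
Proof.
exists qcoord.
  move=> c u v; rewrite /qcoord scale_row_mx add_row_mx; congr row_mx;
    apply/matrixP => i j; rewrite !mxE big_ord1 !mxE eqxx mulr1n;
    move: (u j 0) (v j 0) c => [? ? ? ?] [? ? ? ?] [? ?];
    by apply/eqP; rewrite eq_complex /=; apply/andP; split; apply/eqP; rewrite ?qE /=; ring.
exists qcoord_inv => [u|v]; rewrite /qcoord_inv /qcoord.
  apply/matrixP => i j; rewrite ord1 row_mxKl row_mxKr !mxE /= opprK.
  by case: (u i 0).
rewrite -[RHS]hsubmxK; congr row_mx; apply/matrixP => i j; rewrite ord1 !mxE /= ?opprK.
  by case: (v 0 _).
by case: (v 0 _).
Qed.
HB.instance Definition _ := Lmodule_hasFinDim.Build R[i] qspace qspace_vector.

Lemma dim_qspace : \dim {: qspace} = (m + m)%N.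
Proof. by rewrite dimvf. Qed.

End QuaternionicSpace.

Section MatrixRepresentation.
Variables (R : realType) (m : nat) (g : lmodType R) (br : g -> g -> g).
Notation H := (quat R).
Variable rho : g -> 'M[H]_m.

(** The complex-linear extension of [rho]: the imaginary unit of the complexification acts as right
    multiplication by i. *)
Definition matrix_act (x : complexification g) (u : qspace R m) : qspace R m :=
  rho x.1 *m u + rho x.2 *m u *q qi R.

Lemma matrix_act_linear x : linear (matrix_act x).
Proof.
move=> c u v; rewrite /matrix_act.
have E (A : 'M[H]_m) : A *m (c *: u + v : qspace R m) = A *m u *q toq c + A *m v.
  by rewrite mulmxDr mulmxA.
rewrite !E mulmxDl addrACA; congr (_ + _).
rewrite rscalA -toqi -toqM mulrC toqM -rscalA -mulmxDl//.
Qed.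
HB.instance Definition _ x := GRing.isLinear.Build R[i] (qspace R m) (qspace R m) *:%R
  (matrix_act x) (matrix_act_linear x).

Hypothesis rhoL : forall (a : R) x y, rho (a *: x + y) = (realq a)%:M *m rho x + rho y.
Hypothesis rhoM : forall x y, rho (br x y) = rho x *m rho y - rho y *m rho x.

Lemma rho_additive x y : rho (x + y) = rho x + rho y.
Proof. by rewrite -[x in LHS]scale1r rhoL realq1 mul1mx. Qed.

Lemma rho_zero : rho 0 = 0.
Proof. by apply: (addrI (rho 0)); rewrite -rho_additive !addr0. Qed.

Lemma rho_scale (a : R) x : rho (a *: x) = (realq a)%:M *m rho x.
Proof. by rewrite -[_ *: x]addr0 rhoL rho_zero addr0. Qed.

Lemma rho_opp x : rho (- x) = - rho x.
Proof. by apply/eqP; rewrite -addr_eq0 -rho_additive addNr rho_zero. Qed.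

Lemma qspace_scaleE c (u : qspace R m) : c *: u = u *q toq c.
Proof. by []. Qed.

Lemma toqE (c : R[i]) : toq c = realq (complex.Re c) + qi R * realq (complex.Im c).
Proof. by apply: quatP; rewrite ?qE /=; ring. Qed.

Lemma qi2 : qi R * qi R = -1.
Proof. by apply: quatP; rewrite ?qE /=; ring. Qed.

Lemma matrix_act_rhoL a x y u :
  matrix_act (a *: x + y) u = a *: matrix_act x u + matrix_act y u.
Proof.
have -> : matrix_act (a *: x + y) u =
    rho (complex.Re a *: x.1 - complex.Im a *: x.2 + y.1) *m u +
    rho (complex.Re a *: x.2 + complex.Im a *: x.1 + y.2) *m u *q qi R by [].
rewrite !rho_additive rho_opp !rho_scale !mulmxDl mulNmx -!mulmxA.
rewrite -!real_scalar_comm !mulmxA qspace_scaleE /matrix_act toqE.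
move: (rho x.1 *m u) (rho x.2 *m u) (rho y.1 *m u) (rho y.2 *m u) => P Q S T.
rewrite !mulmxDl !rscalDr !rscalA mulrA qi2 mulN1r rscalNr -!realqC.
rewrite [LHS]addrACA; congr (_ + _).
by rewrite [X in _ + X]addrC [LHS]addrACA [- _ + _]addrC.
Qed.

Lemma matrix_act_of_real x u : matrix_act (of_real x) u = rho x *m u.
Proof. by rewrite /matrix_act -[(of_real x).2]/(0 : g) rho_zero !mul0mx addr0. Qed.

Lemma matrix_act_bracket x y u : matrix_act (bracketC br x y) u =
  matrix_act x (matrix_act y u) - matrix_act y (matrix_act x u).
Proof.
have -> : matrix_act (bracketC br x y) u =
    rho (br x.1 y.1 - br x.2 y.2) *m u + rho (br x.1 y.2 + br x.2 y.1) *m u *q qi R by [].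
rewrite !rho_additive rho_opp !rhoM /matrix_act.
move: (rho x.1) (rho x.2) (rho y.1) (rho y.2) => A B C D.
rewrite !mulmxDr !mulmxDl !mulNmx !mulmxDl !mulNmx !mulmxA.
rewrite !rscalA !qi2 !rscalNr !rscal1 !opprD !opprK !addrA.
by rewrite [LHS](ACl (1*5*7*3*2*8*6*4)).
Qed.

Lemma matrix_rep_g_quaternionic :
  exists2 F : complexification g -> 'End(qspace R m), g_quaternionic br F &
    forall x u, F (of_real x) u = rho x *m u.
Proof.
have [F FE] : exists F : complexification g -> 'End(qspace R m),
    forall x u, F x u = matrix_act x u.
  by exists (fun x => linfun (matrix_act x)) => x u; exact: lfunE.
have Fr x u : F (of_real x) u = rho x *m u by rewrite FE matrix_act_of_real.
exists F => //; split; [split|split; [split|]].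
- move=> a x y; apply/lfunP => u.
  by rewrite add_lfunE scale_lfunE !FE matrix_act_rhoL.
- move=> x y; apply/lfunP => u.
  by rewrite add_lfunE opp_lfunE !comp_lfunE !FE matrix_act_bracket.
- move=> a x y; apply/lfunP => u.
  rewrite add_lfunE scale_lfunE !Fr qspace_scaleE.
  by rewrite rhoL mulmxDl -mulmxA -real_scalar_comm.
- move=> x y; apply/lfunP => u.
  by rewrite add_lfunE opp_lfunE !comp_lfunE !Fr rhoM mulmxBl !mulmxA.
exists (fun u => u *q qj R); split.
- move=> c u v; rewrite mulmxDl; congr (_ + _).
  by rewrite !qspace_scaleE !rscalA toq_conj.
- move=> v; rewrite rscalA -[RHS]rscal1 mulNmx -mulmxN -scalar_mxN; congr (_ *q _).
  by apply: quatP; rewrite ?qE /=; ring.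
- by move=> x v; rewrite !Fr mulmxA.
Qed.

End MatrixRepresentation.

(** * Differential calculus *)

Section DirectionalDerivatives.
Variable R : realType.
Implicit Types E F W : normedModType R.

Lemma derive_comp E F W (f : E -> F) (g : F -> W) x v :
  differentiable f x -> differentiable g (f x) ->
  'D_v (g \o f) x = 'D_('D_v f x) g (f x).
Proof.
move=> df dg; rewrite (deriveE v (differentiable_comp df dg)) (deriveE _ dg).
by rewrite (deriveE v df) (diff_comp df dg).
Qed.

Lemma derive_linearP E W (f : E -> W) x (a : R) u v : differentiable f x ->
  'D_(a *: u + v) f x = a *: 'D_u f x + 'D_v f x.
Proof. by move=> df; rewrite !(deriveE _ df) linearP. Qed.

Lemma derive_dirD E W (f : E -> W) x u v : differentiable f x ->
  'D_(u + v) f x = 'D_u f x + 'D_v f x.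
Proof. by move=> df; rewrite !(deriveE _ df) linearD. Qed.

Lemma derive_dirZ E W (f : E -> W) x (a : R) u : differentiable f x ->
  'D_(a *: u) f x = a *: 'D_u f x.
Proof. by move=> df; rewrite !(deriveE _ df) linearZ. Qed.

Lemma differentiable_line E x (u : E) (s : R) :
  differentiable (fun t : R => x + t *: u) s.
Proof.
apply: differentiableD; first exact: differentiable_cst.
exact: (@differentiableZl _ _ _ id).
Qed.

Lemma derive_line E (x u : E) (s : R) : 'D_1 (fun t : R => x + t *: u) s = u.
Proof.
rewrite deriveD//; last exact/diff_derivable/(@differentiableZl _ _ _ id).
rewrite derive_cst add0r deriveE; last exact/(@differentiableZl _ _ _ id).
by rewrite (@diffZl _ _ _ id)// diff_val /= scale1r.
Qed.

Lemma is_derive_line E W (f : E -> W) x u (s : R) : differentiable f (x + s *: u) ->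
  is_derive s 1 (fun t => f (x + t *: u)) ('D_u f (x + s *: u)).
Proof.
move=> df; have dl := differentiable_line x u s.
apply: DeriveDef; first exact/diff_derivable/(@differentiable_comp _ _ _ _ (fun t : R => x + t *: u)).
by rewrite (@derive_comp _ _ _ (fun t : R => x + t *: u) f)// derive_line.
Qed.

Lemma diff_approx E W (f : E -> W) x : differentiable f x -> forall e : R, 0 < e ->
  exists2 r, 0 < r &
    forall h, `|h| < r -> `|f (x + h) - f x - 'D_h f x| <= e * `|h|.
Proof.
move=> df e e0; have /diff_locally/eqaddoP/(_ e e0) := df.
move=> /nbhs_normP[r /= r0 H]; exists r => // h hr.
have := H h; rewrite /= sub0r normrN => /(_ hr).
by rewrite deriveE// !fctE /= opprD addrA [h + x]addrC.
Qed.

End DirectionalDerivatives.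

Section Symmetry.
Variables (R : realType) (E : normedModType R).
Implicit Types (f : E -> R) (x u v : E).

(* Mean value theorem in the direction u, then differentiability of 'D_u f at x. *)
Lemma second_difference f x u v : (\forall y \near x, differentiable f y) ->
  differentiable ('D_u f) x -> forall e : R, 0 < e ->
  exists2 r, 0 < r & forall s, 0 < s -> s < r ->
    `|f (x + s *: v + s *: u) - f (x + s *: u) - (f (x + s *: v) - f x) -
      s ^+ 2 * 'D_v ('D_u f) x| <= e * s ^+ 2.
Proof.
move=> ndf dg e e0.
have auxK (a b : R) : a + b + a <= 2 * a + b + 1 by lra.
set g := 'D_u f in dg *.
(* The two linearisation errors are proportional to |u| + |v| and |u|, with sum 2 |u| + |v|; the
   extra 1 keeps [K] positive when both vectors vanish. *)
pose K := 2 * `|u| + `|v| + 1.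
have K0 : 0 < K by rewrite /K ltr_wpDl// addr_ge0// mulr_ge0.
have [r1 r10 H1] := diff_approx dg (divr_gt0 e0 K0).
move/nbhs_normP : ndf => [r0 /= r00 H0].
exists (Num.min r0 r1 / K); first by rewrite divr_gt0// lt_min r00.
move=> s s0; rewrite ltr_pdivlMr// lt_min => /andP[sr0 sr1].
have small t : 0 <= t -> t <= s -> `|t *: u| <= s * `|u|.
  by move=> t0 ts; rewrite normrZ ger0_norm// ler_wpM2r.
have smallv : `|s *: v| = s * `|v| by rewrite normrZ gtr0_norm.
have sK t : 0 <= t -> t <= s -> `|s *: v + t *: u| <= s * (`|u| + `|v|) /\
    s * (`|u| + `|v|) < s * K.
  move=> t0 ts; split.
    by rewrite (le_trans (ler_normD _ _))// smallv mulrDr addrC lerD// small.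
  by rewrite ltr_pM2l// /K; have := normr_ge0 u; lra.
have sK' t : 0 <= t -> t <= s -> `|t *: u| < s * K.
  move=> t0 ts; rewrite (le_lt_trans (small t t0 ts))// ltr_pM2l// /K.
  by have := normr_ge0 u; have := normr_ge0 v; lra.
have df1 t : 0 <= t -> t <= s -> differentiable f (x + s *: v + t *: u).
  move=> t0 ts; apply: H0; rewrite /= -addrA opprD addrA subrr add0r normrN.
  by have [? ?] := sK t t0 ts; lra.
have df2 t : 0 <= t -> t <= s -> differentiable f (x + t *: u).
  move=> t0 ts; apply: H0; rewrite /= opprD addrA subrr add0r normrN.
  by have ? := sK' t t0 ts; lra.
pose phi t : R := f (x + s *: v + t *: u) - f (x + t *: u).
have dphi t : 0 <= t -> t <= s ->
    is_derive t 1 phi (g (x + s *: v + t *: u) - g (x + t *: u)).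
  by move=> t0 ts; apply: is_deriveB; apply: is_derive_line; auto.
have [|||xi] := @MVT R phi (fun t => g (x + s *: v + t *: u) - g (x + t *: u)) 0 s.
- exact: s0.
- by move=> t; rewrite in_itv /= => /andP[/ltW t0 /ltW ts]; exact: dphi.
- apply: derivable_within_continuous => t; rewrite in_itv /= => /andP[t0 ts].
  by have := dphi t t0 ts => ?; exact: ex_derive.
rewrite in_itv /= => /andP[/ltW xi0 /ltW xis].
rewrite subr0 /phi scale0r !addr0 => ->.
have [le1 lt1] := sK xi xi0 xis; have lt2 := sK' xi xi0 xis.
have A1 : `|g (x + (s *: v + xi *: u)) - g x - 'D_(s *: v + xi *: u) g x| <=
    e / K * (s * (`|u| + `|v|)).
  rewrite (le_trans (H1 _ _))//; first by lra.
  by rewrite ler_pM2l ?divr_gt0.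
have A2 : `|g (x + xi *: u) - g x - 'D_(xi *: u) g x| <= e / K * (s * `|u|).
  rewrite (le_trans (H1 _ _))//; first by lra.
  by rewrite ler_pM2l ?divr_gt0// small.
have -> : (g (x + s *: v + xi *: u) - g (x + xi *: u)) * s - s ^+ 2 * 'D_v g x =
  s * ((g (x + (s *: v + xi *: u)) - g x - 'D_(s *: v + xi *: u) g x) -
       (g (x + xi *: u) - g x - 'D_(xi *: u) g x)).
  rewrite (derive_linearP _ _ _ dg) addrA -[s *: 'D_v g x]/(s * 'D_v g x).
  have aux (a b c d p : R) : (a - b) * s - s ^+ 2 * d =
    s * (a - c - (s * d + p) - (b - c - p)) by ring.
  exact: aux.
rewrite normrM gtr0_norm// expr2 mulrCA ler_pM2l//.
rewrite (le_trans (ler_normB _ _))// (le_trans (lerD A1 A2))//.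
rewrite -mulrDr -mulrDr [X in X <= _](_ : _ = e * s * ((`|u| + `|v| + `|u|) / K)); last by ring.
apply: ler_piMr; first by rewrite mulr_ge0// ltW.
by rewrite ler_pdivrMr// mul1r; exact: auxK.
Qed.

(** The second difference is symmetric in [u] and [v], and s^2 times either mixed derivative
    approximates it within (e/2) s^2; dividing by s^2 bounds their distance by e. *)
Lemma derive_sym f x u v : (\forall y \near x, differentiable f y) ->
  differentiable ('D_u f) x -> differentiable ('D_v f) x ->
  'D_v ('D_u f) x = 'D_u ('D_v f) x.
Proof.
move=> ndf du dv; apply/eqP; rewrite -subr_eq0 -normr_le0; apply/ler_addgt0Pl => e e0.
rewrite addr0.
have e20 : 0 < e / 2 by rewrite divr_gt0.
have [r1 r10 H1] := second_difference v ndf du e20.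
have [r2 r20 H2] := second_difference u ndf dv e20.
pose s := Num.min r1 r2 / 2.
have m0 : 0 < Num.min r1 r2 by rewrite lt_min r10.
have s0 : 0 < s by rewrite divr_gt0.
have sm : s < Num.min r1 r2 by rewrite /s; lra.
have [s1 s2] : s < r1 /\ s < r2 by apply/andP; rewrite -lt_min.
have := H1 s s0 s1; have := H2 s s0 s2.
rewrite [x + s *: u + s *: v]addrAC.
move: (f _) (f _) (f _) (f _) ('D_v _ x) ('D_u _ x) => a b c d p q A B.
have s20 : 0 < s ^+ 2 by rewrite exprn_gt0.
rewrite -(ler_pM2r s20) -[s ^+ 2 in leLHS]gtr0_norm// -normrM.
have -> : (p - q) * s ^+ 2 = (d - c - (b - a) - s ^+ 2 * q) - (d - b - (c - a) - s ^+ 2 * p).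
  by ring.
rewrite (le_trans (ler_normB _ _))// (le_trans (lerD A B))//; lra.
Qed.

End Symmetry.

Section VectorValued.
Variable R : realType.
Implicit Types E W : normedModType R.

Lemma differentiable_near E W (f g : E -> W) x : (\forall y \near x, f y = g y) ->
  differentiable f x -> differentiable g x.
Proof.
move=> fg df; have fx := nbhs_singleton fg.
have gE : g \o shift x = cst (g x) + 'd f x +o_ 0 id.
  apply/eqaddoP => e e0; have /diff_locally/eqaddoP/(_ e e0) H := df.
  have {}fg : \forall h \near 0, f (h + x) = g (h + x).
    move: fg; rewrite (near_shift 0 x) subr0; exact: filterS.
  near=> h; have -> : (g \o shift x - (cst (g x) + 'd f x)) h =
      (f \o shift x - (cst (f x) + 'd f x)) h.
    by rewrite !fctE /= fx; congr (_ - _); apply/esym; near: h.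
  by near: h.
apply/diff_locallyP; rewrite (diff_unique (diff_continuous df) gE).
by split => //; exact: diff_continuous.
Unshelve. all: by end_near. Qed.

Lemma differentiable_entry E m (F : E -> 'rV[R]_m) x j : differentiable F x ->
  differentiable (fun y => F y 0 j) x.
Proof.
move=> dF; apply: (@differentiable_comp _ _ _ _ F (fun M : 'rV[R]_m => M 0 j)) => //.
exact: differentiable_coord.
Qed.

Lemma derive_entry E m (F : E -> 'rV[R]_m) x v j : differentiable F x ->
  'D_v (fun y => F y 0 j) x = 'D_v F x 0 j.
Proof. by move=> dF; rewrite derive_mx ?mxE//; exact: diff_derivable. Qed.

Lemma differentiable_entries E m (F : E -> 'rV[R]_m) x :
  (forall j, differentiable (fun y => F y 0 j) x) -> differentiable F x.
Proof.
move=> dF; have -> : F = (fun y => \sum_(j < m) F y 0 j *: delta_mx 0 j).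
  by apply/funext => y; exact: row_sum_delta.
rewrite -[X in differentiable X _]fct_sumE.
apply: differentiable_sum => j; exact: differentiableZl.
Qed.
End VectorValued.

Section SmoothVectorFunctions.
Variable R : realType.
Implicit Types E W : normedModType R.

Lemma Cinfty_differentiable E W (U : set E) (f : E -> W) x :
  Cinfty U f -> U x -> differentiable f x.
Proof. by move=> /(_ 1%N)[+ _]; exact. Qed.

Lemma Cinfty_derive E W (U : set E) (f : E -> W) v : Cinfty U f -> Cinfty U ('D_v f).
Proof. by move=> Uf k; have [_] := Uf k.+1; exact. Qed.

Lemma Cinfty_near E W (U : set E) (f : E -> W) x : open U -> Cinfty U f -> U x ->
  \forall y \near x, differentiable f y.
Proof.
move=> oU Uf Ux; have : nbhs x U by exact: open_nbhs_nbhs.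
by apply: filterS => y; exact: Cinfty_differentiable.
Qed.

(** [derive_sym] rests on the mean value theorem and concerns real-valued functions, so the proof
    passes to entries. *)
Lemma Cinfty_derive_sym E m (U : set E) (F : E -> 'rV[R]_m) x u v :
  open U -> Cinfty U F -> U x -> 'D_v ('D_u F) x = 'D_u ('D_v F) x.
Proof.
move=> oU UF Ux; have nF := Cinfty_near oU UF Ux.
have dD w : differentiable ('D_w F) x.
  exact: Cinfty_differentiable (Cinfty_derive w UF) Ux.
have E1 w z j : 'D_z ('D_w F) x 0 j = 'D_z ('D_w (fun y => F y 0 j)) x.
  apply: etrans (esym (derive_entry z j (dD w))) _.
  apply: near_eq_derive; near=> y; apply/esym/derive_entry; near: y; exact: nF.
have dE w j : differentiable ('D_w (fun y => F y 0 j)) x.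
  apply: (@differentiable_near _ _ _ (fun y => 'D_w F y 0 j)).
    near=> y; apply/esym/derive_entry; near: y; exact: nF.
  exact: differentiable_entry.
apply/rowP => j; apply: etrans (E1 u v j) _; apply: etrans _ (esym (E1 v u j)).
apply: derive_sym; [|exact: dE..].
near=> y; apply: differentiable_entry; near: y; exact: nF.
Unshelve. all: by end_near. Qed.

Lemma zero_derive_constant E m (F : E -> 'rV[R]_m) x (r : R) :
  (forall y, ball x r y -> differentiable F y) ->
  (forall y v, ball x r y -> 'D_v F y = 0) ->
  forall y, ball x r y -> F y = F x.
Proof.
move=> dF F0 y; rewrite -ball_normE /= => xy; apply/rowP => j.
pose phi (t : R) : R := F (x + t *: (y - x)) 0 j.
have inb (t : R) : 0 <= t -> t <= 1 -> ball x r (x + t *: (y - x)).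
  move=> t0 t1; rewrite -ball_normE /= opprD addrA subrr add0r normrN normrZ.
  by rewrite ger0_norm// distrC (le_lt_trans _ xy)// ler_piMl.
have dphi (t : R) : 0 <= t -> t <= 1 -> is_derive t 1 phi 0.
  move=> t0 t1; have db := dF _ (inb _ t0 t1).
  have -> : (0 : R) = 'D_(y - x) (fun z => F z 0 j) (x + t *: (y - x)).
    by rewrite (derive_entry _ _ db) (F0 _ _ (inb _ t0 t1)) mxE.
  by apply: (@is_derive_line _ _ _ (fun z => F z 0 j)); exact: differentiable_entry.
have [|||c] := @MVT R phi (fun=> 0) 0 1; first exact: ltr01.
- by move=> t; rewrite in_itv /= => /andP[/ltW t0 /ltW t1]; exact: dphi.
- apply: derivable_within_continuous => t; rewrite in_itv /= => /andP[t0 t1].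
  by have := dphi t t0 t1 => ?; exact: ex_derive.
move=> _; rewrite mul0r => /eqP; rewrite subr_eq0 => /eqP.
by rewrite /phi scale1r scale0r addr0 addrCA subrr addr0.
Qed.

(** A product rule for maps linear in their second argument. Expanding in the standard basis reduces
    it to finitely many products, so [Phi] need only be differentiable in [a] for each fixed
    vector. *)
Lemma derive_linear_family E d m (Phi : E -> 'rV[R]_d -> 'rV[R]_m) (L : E -> 'rV[R]_d) x v :
  (\forall a \near x, forall c u w, Phi a (c *: u + w) = c *: Phi a u + Phi a w) ->
  (forall u, differentiable (Phi^~ u) x) -> differentiable L x ->
  differentiable (fun a => Phi a (L a)) x /\
  'D_v (fun a => Phi a (L a)) x = 'D_v (Phi^~ (L x)) x + Phi x ('D_v L x).
Proof.
move=> lin dPhi dL.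
have expand a (u : 'rV_d) : (forall c u w, Phi a (c *: u + w) = c *: Phi a u + Phi a w) ->
    Phi a u = \sum_i u 0 i *: Phi a (delta_mx 0 i).
  move=> la; have la0 : Phi a 0 = 0.
    by have := la (-1) 0 0; rewrite scaler0 addr0 scaleN1r addNr.
  have laD : {morph Phi a : u w / u + w >-> u + w}.
    by move=> u1 w; rewrite -[u1 in LHS]scale1r la scale1r.
  rewrite {1}[u]row_sum_delta (big_morph _ laD la0); apply: eq_bigr => i _.
  by rewrite -[_ *: _]addr0 la la0 addr0.
have dPE i j : differentiable (fun a => Phi a (delta_mx 0 i) 0 j) x.
  exact: differentiable_entry (dPhi _).
have dLE i : differentiable (fun a => L a 0 i) x by exact: differentiable_entry.
pose S a := \sum_i L a 0 i *: Phi a (delta_mx 0 i).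
pose P a := \sum_i L x 0 i *: Phi a (delta_mx 0 i).
have dS j : is_derive x v (fun a => S a 0 j)
    (\sum_i (L x 0 i *: 'D_v (fun a => Phi a (delta_mx 0 i) 0 j) x +
      Phi x (delta_mx 0 i) 0 j *: 'D_v (fun a => L a 0 i) x)).
  have -> : (fun a => S a 0 j) =
      \sum_i ((fun a => L a 0 i) * (fun a => Phi a (delta_mx 0 i) 0 j)).
    apply/funext => a; rewrite fct_sumE summxE; apply: eq_bigr => i _.
    by rewrite mxE.
  apply: is_derive_sum => i; apply: is_deriveM; exact/derivableP/diff_derivable.
have diffS : differentiable S x.
  have -> : S = \sum_i (fun a => L a 0 i *: Phi a (delta_mx 0 i)).
    by apply/funext => a; rewrite fct_sumE.
  apply: differentiable_sum => i; apply: differentiable_entries => j.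
  have -> : (fun a => (L a 0 i *: Phi a (delta_mx 0 i)) 0 j) =
      (fun a => L a 0 i) * (fun a => Phi a (delta_mx 0 i) 0 j).
    by apply/funext => a; rewrite mxE.
  exact: differentiableM.
split.
  apply: (differentiable_near _ diffS).
  by near=> a; apply/esym/expand; near: a.
have -> : 'D_v (fun a => Phi a (L a)) x = 'D_v S x.
  by apply: near_eq_derive; near=> a; apply: expand; near: a.
have -> : 'D_v (Phi^~ (L x)) x = 'D_v P x.
  by apply: near_eq_derive; near=> a; apply: expand; near: a.
have -> : 'D_v P x = \sum_i L x 0 i *: 'D_v (Phi^~ (delta_mx 0 i)) x.
  have -> : P = \sum_i (L x 0 i \*: Phi^~ (delta_mx 0 i)).
    by apply/funext => a; rewrite fct_sumE.
  rewrite derive_sum => [|i]; last exact/derivableZ/diff_derivable.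
  by apply: eq_bigr => i _; rewrite deriveZ//; exact: diff_derivable.
rewrite (expand x ('D_v L x)); last exact: nbhs_singleton lin.
apply/rowP => j; rewrite -(derive_entry v j diffS) (@derive_val _ _ _ _ _ _ _ (dS j)).
rewrite mxE !summxE -big_split; apply: eq_bigr => i _ /=.
rewrite !mxE -(derive_entry v j (dPhi _)) -(derive_entry v i dL).
by congr (_ + _); rewrite mulrC.
Unshelve. all: by end_near. Qed.
End SmoothVectorFunctions.

Section QuadraticFields.
Variables (R : realType) (p m : nat).
Notation E := 'rV[R]_p.
Notation W := 'rV[R]_m.

Lemma affine_part (f : E -> W) y0 y w : differentiable f y0 ->
  differentiable (fun z => 'D_(z - y0) f y0) y /\
  'D_w (fun z => 'D_(z - y0) f y0) y = 'D_w f y0.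
Proof.
move=> df; have -> : (fun z => 'D_(z - y0) f y0) = 'd f y0 \o (fun z => z - y0).
  by apply/funext => z; rewrite (deriveE _ df).
have ds : differentiable (fun z : E => z - y0) y.
  by apply: differentiableB; [exact: ex_diff|exact: differentiable_cst].
have dl z : differentiable ('d f y0) z.
  by apply: linear_differentiable; exact: diff_continuous.
split; first exact: differentiable_comp.
apply: etrans (derive_comp w ds (dl _)) _.
have -> : 'D_w (fun z : E => z - y0) y = w.
  rewrite deriveB; [|exact/diff_derivable|exact: derivable_cst].
  by rewrite derive_id derive_cst subr0.
by rewrite (deriveE _ (dl _)) (diff_lin _ (diff_continuous df)) (deriveE _ df).
Qed.

(** The second derivatives are constant on the ball, so the first ones are affine and [X] is
    quadratic: at each stage the difference with the candidate has zero derivative. *)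
Lemma quadratic_expansion (X : E -> W) (U : set E) y0 r : open U -> Cinfty U X ->
  (forall y u v w, U y -> 'D_w ('D_v ('D_u X)) y = 0) ->
  0 < r -> ball y0 r `<=` U -> forall y, ball y0 r y ->
  (forall k, 'D_k X y = 'D_k X y0 + 'D_(y - y0) ('D_k X) y0) /\
  X y = X y0 + 'D_(y - y0) X y0 + 2^-1 *: 'D_(y - y0) ('D_(y - y0) X) y0.
Proof.
move=> oU UX X3 r0 rU.
have U0 : U y0 by apply: rU; exact: ballxx.
have UX1 u := Cinfty_derive u UX.
have UX2 u v := Cinfty_derive v (UX1 u).
have dX1 u y (Uy : U y) := Cinfty_differentiable (UX1 u) Uy.
have dX2 u v y (Uy : U y) := Cinfty_differentiable (UX2 u v) Uy.
have sym u v y (Uy : U y) := Cinfty_derive_sym u v oU UX Uy.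
have c2 u v y : ball y0 r y -> 'D_v ('D_u X) y = 'D_v ('D_u X) y0.
  apply: (@zero_derive_constant R _ _ ('D_v ('D_u X)) y0 r) => [z /rU Uz|z w /rU].
    exact: dX2.
  exact: X3.
have c1 k y : ball y0 r y -> 'D_k X y = 'D_k X y0 + 'D_(y - y0) ('D_k X) y0.
  have aff z w := affine_part z w (dX1 k y0 U0).
  move=> yb; pose G (z : E) : W := 'D_k X z - 'D_(z - y0) ('D_k X) y0.
  have : G y = G y0.
    apply: (@zero_derive_constant R _ _ G y0 r) => [z /rU Uz|z w zb|]; last exact: yb.
      by apply: differentiableB; [exact: dX1|have [] := aff z 0].
    have Uz := rU _ zb; have [da Ea] := aff z w.
    rewrite /G deriveB; [|exact/diff_derivable/dX1|exact/diff_derivable].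
    by apply/eqP; rewrite subr_eq0 Ea; apply/eqP; exact: c2.
  by rewrite /G subrr derive0 subr0 => <-; rewrite subrK.
move=> y yb; split=> [k|]; first exact: c1.
(* On u = z - y0 this is twice the quadratic Taylor term. Both occurrences of z contribute the same
   derivative, by symmetry, whence a factor 2 that [2^-1] cancels. *)
pose Phi z u := 'D_u ('D_(z - y0) X) y0.
have PhiE u : Phi^~ u = fun z => 'D_(z - y0) ('D_u X) y0.
  by apply/funext => z; exact: sym.
have quad z w : differentiable (fun z => Phi z (z - y0)) z /\
    'D_w (fun z => Phi z (z - y0)) z = 2 *: 'D_(z - y0) ('D_w X) y0.
  have dl : differentiable (fun z : E => z - y0) z.
    by apply: differentiableB; [exact: ex_diff|exact: differentiable_cst].
  have lin : \forall a \near z, forall (c : R) u v,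
      Phi a (c *: u + v) = c *: Phi a u + Phi a v.
    by apply: filterE => a c u v; exact: derive_linearP (dX1 _ _ U0).
  have dPhi u : differentiable (Phi^~ u) z.
    by rewrite PhiE; have [] := affine_part z 0 (dX1 u y0 U0).
  have [dQ EQ] := @derive_linear_family R E p m Phi (fun z => z - y0) z w lin dPhi dl.
  split; first exact: dQ.
  apply: etrans EQ _; rewrite PhiE.
  have [_ ->] := affine_part z w (dX1 (z - y0) y0 U0).
  have -> : 'D_w (fun z : E => z - y0) z = w.
    rewrite deriveB; [|exact/diff_derivable|exact: derivable_cst].
    by rewrite derive_id derive_cst subr0.
  have S : 'D_w ('D_(z - y0) X) y0 = 'D_(z - y0) ('D_w X) y0 by exact: sym.
  have dbl (b : W) : b + b = 2 *: b by rewrite scaler_nat.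
  rewrite /Phi S.
  move: ('D__ _ _) => b.
  exact: dbl.
pose G (z : E) : W := X z - ('D_(z - y0) X y0 + 2^-1 *: Phi z (z - y0)).
have dX0 : differentiable X y0 by exact: Cinfty_differentiable U0.
have : G y = G y0.
  apply: (@zero_derive_constant R _ _ G y0 r) => [z /rU Uz|z w zb|]; last exact: yb.
    apply: differentiableB; first exact: Cinfty_differentiable Uz.
    apply: differentiableD; first by have [] := affine_part z 0 dX0.
    by apply: differentiableZ; have [] := quad z 0.
  have Uz := rU _ zb; have [da Ea] := affine_part z w dX0.
  have [dq Eq] := quad z w.
  have dX : differentiable X z by exact: Cinfty_differentiable Uz.
  have dq' := differentiableZ 2^-1 dq.
  rewrite /G deriveB; [|exact/diff_derivable|exact/diff_derivable/differentiableD].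
  rewrite deriveD; [|exact/diff_derivable|exact/diff_derivable].
  rewrite Ea deriveZ; last exact/diff_derivable.
  rewrite Eq scalerA mulVf ?pnatr_eq0// scale1r.
  by apply/eqP; rewrite subr_eq0; apply/eqP; exact: c1.
have -> : G y0 = X y0 by rewrite /G /Phi subrr !derive0 scaler0 addr0 subr0.
by move=> <-; rewrite -addrA /G subrK.
Qed.
End QuadraticFields.

(** * Fundamental vector fields *)

Section Slices.
Variable R : realType.
Implicit Types E F W : normedModType R.

Lemma derive_pair E F W (f : E -> F) (g : E -> W) x v :
  differentiable f x -> differentiable g x ->
  'D_v (fun y => (f y, g y)) x = ('D_v f x, 'D_v g x).
Proof.
move=> df dg; rewrite (deriveE v (differentiable_pair df dg)) (diff_pair df dg).
by rewrite (deriveE v df) (deriveE v dg).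
Qed.

Lemma derive_comp2 E F1 F2 W (G : F1 * F2 -> W) (f : E -> F1) (g : E -> F2) x v :
  differentiable f x -> differentiable g x -> differentiable G (f x, g x) ->
  differentiable (fun y => G (f y, g y)) x /\
  'D_v (fun y => G (f y, g y)) x = 'D_('D_v f x, 'D_v g x) G (f x, g x).
Proof.
move=> df dg dG; have dp := differentiable_pair df dg; split.
  exact: (@differentiable_comp _ _ _ _ (fun y => (f y, g y)) G).
by rewrite -derive_pair//; apply: (@derive_comp _ _ _ _ (fun y => (f y, g y)) G).
Qed.

Lemma derive_comp2_at E F1 F2 W (G : F1 * F2 -> W) (f : E -> F1) (g : E -> F2) x v p q u w :
  differentiable f x -> differentiable g x -> differentiable G (p, q) ->
  f x = p -> g x = q -> 'D_v f x = u -> 'D_v g x = w ->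
  'D_v (fun y => G (f y, g y)) x = 'D_(u, w) G (p, q).
Proof.
by move=> df dg dG fp gq fu gw; subst p q u w; have [] := derive_comp2 v df dg dG.
Qed.

Lemma derive_slice2 F1 F2 W (G : F1 * F2 -> W) a y v : differentiable G (a, y) ->
  differentiable (fun z => G (a, z)) y /\
  'D_v (fun z => G (a, z)) y = 'D_(0, v) G (a, y).
Proof.
move=> dG; have [] := @derive_comp2 F2 F1 F2 W G (cst a) id y v.
- exact: differentiable_cst.
- exact: ex_diff.
- exact: dG.
by move=> dg; rewrite derive_cst derive_id.
Qed.

Lemma derive_slice1 F1 F2 W (G : F1 * F2 -> W) a y v : differentiable G (a, y) ->
  differentiable (fun z => G (z, y)) a /\
  'D_v (fun z => G (z, y)) a = 'D_(v, 0) G (a, y).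
Proof.
move=> dG; have [] := @derive_comp2 F1 F1 F2 W G id (cst y) a v.
- exact: ex_diff.
- exact: differentiable_cst.
- exact: dG.
by move=> dg; rewrite derive_cst derive_id.
Qed.

Lemma Ck_ext E W (U : set E) (f g : E -> W) k : open U ->
  (forall x, U x -> f x = g x) -> Ck k U f -> Ck k U g.
Proof.
move=> oU; elim: k f g => [|k IH] f g fg.
  move=> Uf x Ux; have nx : nbhs x U by exact: open_nbhs_nbhs.
  change (g y @[y --> x] --> g x).
  have H : f y @[y --> x] --> f x := Uf x Ux.
  rewrite -(fg x Ux); apply: cvg_trans H.
  by apply: near_eq_cvg; apply: filterS nx => y /fg.
move=> [df cf]; split=> [x Ux|v].
  apply: differentiable_near (df x Ux).
  by apply: filterS (open_nbhs_nbhs (conj oU Ux)) => y /fg.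
apply: IH (cf v) => x Ux; apply: near_eq_derive.
by apply: filterS (open_nbhs_nbhs (conj oU Ux)) => y /fg.
Qed.

Lemma Ck_sub E W (U V : set E) (f : E -> W) k : U `<=` V -> Ck k V f -> Ck k U f.
Proof.
move=> UV; elim: k f => [|k IH] f /=; first by move=> Vf x /UV; exact: Vf.
by move=> [df cf]; split=> [x /UV|v]; [exact: df|exact: IH].
Qed.

Lemma continuous_slice1 F1 F2 (y : F2) : continuous (fun a : F1 => (a, y)).
Proof. by move=> a; apply: cvg_pair; [exact: cvg_id|exact: cvg_cst]. Qed.

Lemma near_slice1 F1 F2 (O : set (F1 * F2)) a y : open O -> O (a, y) ->
  \forall z \near a, O (z, y).
Proof.
move=> oO Oay; apply: (@open_nbhs_nbhs _ a [set z | O (z, y)]); split=> //.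
by apply: open_comp oO => z _; exact: continuous_slice1.
Qed.

Lemma continuous_slice2 F1 F2 (a : F1) : continuous (fun y : F2 => (a, y)).
Proof. by move=> y; apply: cvg_pair; [exact: cvg_cst|exact: cvg_id]. Qed.

Lemma near_slice2 F1 F2 (O : set (F1 * F2)) a y : open O -> O (a, y) ->
  \forall z \near y, O (a, z).
Proof.
move=> oO Oay; apply: (@open_nbhs_nbhs _ y [set z | O (a, z)]); split=> //.
by apply: open_comp oO => z _; exact: continuous_slice2.
Qed.

Lemma Cinfty_slice2 F1 F2 W (O : set (F1 * F2)) (G : F1 * F2 -> W) a : open O ->
  Cinfty O G -> Cinfty [set y | O (a, y)] (fun y => G (a, y)).
Proof.
move=> oO OG k; have oS : open [set y | O (a, y)].
  by apply: open_comp oO => y _; exact: continuous_slice2.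
have {OG} := OG k; elim: k G => [|k IH] G.
  move=> cG y Oy; apply: (@continuous_comp _ _ _ (fun z => (a, z)) G).
    exact: continuous_slice2.
  exact: cG.
move=> [dG cG]; split=> [y Oy|v].
  by have [] := derive_slice2 0 (dG _ Oy).
apply: (@Ck_ext _ _ _ (fun y => 'D_(0, v) G (a, y))) oS _ (IH _ (cG _)).
by move=> y Oy; have [_ ->] := derive_slice2 v (dG _ Oy).
Qed.
End Slices.

Section FundamentalFields.
Variables (R : realType) (d m : nat).
Notation A := 'rV[R]_d.
Notation Y := 'rV[R]_m.
Variables (F : A * Y -> Y) (O : set (A * Y)) (mu : A * A -> A) (O' : set (A * A)).
Variables (e : A) (U : set Y).
Hypotheses (oO : open O) (OF : Cinfty O F) (oO' : open O') (Omu : Cinfty O' mu).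
Hypotheses (oU : open U) (UO : forall y, U y -> O (e, y)).
Hypothesis F1 : forall y, U y -> F (e, y) = y.
Hypothesis O'e : O' (e, e).
Hypothesis mu1r : \forall a \near e, mu (a, e) = a.
Hypothesis mu1l : \forall b \near e, mu (e, b) = b.
(** The neighbourhood of [b] may depend on [a], because the identity is differentiated in [b] for
    fixed [a] before it is differentiated in [a]. *)
Hypothesis FA : forall y, U y ->
  \forall a \near e, \forall b \near e, F (mu (a, b), y) = F (a, F (b, y)).

Definition fund (v : A) (y : Y) : Y := 'D_(v, 0) F (e, y).
Definition linv (v : A) (a : A) : A := 'D_(0, v) mu (a, e).

Let dF y : U y -> differentiable F (e, y).
Proof. by move=> /UO; exact: Cinfty_differentiable. Qed.

Lemma fund_linear y (c : R) v w : U y ->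
  fund (c *: v + w) y = c *: fund v y + fund w y.
Proof.
move=> Uy; have -> : fund (c *: v + w) y = 'D_(c *: (v, 0) + (w, 0)) F (e, y).
  have -> : c *: (v, 0 : Y) + (w, 0) = (c *: v + w, c *: 0 + 0) by [].
  by rewrite scaler0 addr0.
by rewrite (derive_linearP _ _ _ (dF Uy)).
Qed.

Lemma fundB y v w : U y -> fund (v - w) y = fund v y - fund w y.
Proof.
by move=> Uy; rewrite addrC -scaleN1r fund_linear// scaleN1r addrC.
Qed.

Lemma fund_Cinfty v : Cinfty U (fund v).
Proof.
by move=> k; apply: Ck_sub UO _; exact: (Cinfty_slice2 e oO (Cinfty_derive (v, 0) OF)).
Qed.

Lemma linv1 v : linv v e = v.
Proof.
have dmu : differentiable mu (e, e) by exact: Cinfty_differentiable.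
have [_ E] := derive_slice2 v dmu; rewrite /linv -E -[RHS](derive_id e v).
exact: near_eq_derive.
Qed.

(* The derivative of F (mu (a, b), y) = F (a, F (b, y)) with respect to b at e;
   differentiating once more, in a, yields fund_bracket. *)
Lemma fund_infinitesimal_action y w : U y ->
  \forall a \near e, 'D_(linv w a, 0) F (a, y) = 'D_(0, fund w y) F (a, y).
Proof.
move=> Uy.
have nO : \forall a \near e, O (a, y) by apply: near_slice1 => //; exact: UO.
have nO' : \forall a \near e, O' (a, e) by exact: near_slice1.
have nFA := FA Uy.
near=> a.
have dFa : differentiable F (a, y) by apply: (Cinfty_differentiable OF); near: a.
have dmu : differentiable mu (a, e) by apply: (Cinfty_differentiable Omu); near: a.
have mua : mu (a, e) = a by near: a.
have [dm Em] := derive_slice2 w dmu; have [dg Eg] := derive_slice1 w (dF Uy).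
have E1 := @derive_comp2_at R _ _ _ _ F (fun b => mu (a, b)) (cst y) e w _ _ _ _
  dm (differentiable_cst _ _) dFa mua erefl Em (derive_cst _ _ _).
have E2 := @derive_comp2_at R _ _ _ _ F (cst a) (fun b => F (b, y)) e w _ _ _ _
  (differentiable_cst _ _) dg dFa erefl (F1 Uy) (derive_cst _ _ _) Eg.
apply: etrans (esym E1) (etrans _ E2); apply: near_eq_derive; near: a; exact: nFA.
Unshelve. all: by end_near. Qed.

Lemma fund_derive v w y : U y -> 'D_w (fund v) y = 'D_(0, w) ('D_(v, 0) F) (e, y).
Proof.
move=> Uy; have dG := Cinfty_differentiable (Cinfty_derive (v, 0) OF) (UO Uy).
by have [_ ->] := derive_slice2 w dG.
Qed.

(** The right side is minus the bracket of the two vector fields, as it must be for a left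
    action. *)
Lemma fund_bracket v w y : U y ->
  fund ('D_v (linv w) e - 'D_w (linv v) e) y =
  'D_(fund w y) (fund v) y - 'D_(fund v y) (fund w) y.
Proof.
move=> Uy.
have main v1 w1 : 'D_(v1, 0) ('D_(w1, 0) F) (e, y) + fund ('D_v1 (linv w1) e) y =
    'D_(fund w1 y) (fund v1) y.
  have dG u z : differentiable ('D_(u, z) F) (e, y).
    exact: Cinfty_differentiable (Cinfty_derive (u, z) OF) (UO Uy).
  have [_ <-] := derive_slice1 v1 (dG w1 0).
  rewrite fund_derive// (Cinfty_derive_sym _ _ oO OF (UO Uy)).
  have [_ <-] := derive_slice1 v1 (dG 0 (fund w1 y)).
  apply/esym; apply: etrans (esym (near_eq_derive v1 (fund_infinitesimal_action w1 Uy))) _.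
  have dlinv : differentiable (linv w1) e.
    have dG' := Cinfty_differentiable (Cinfty_derive (0, w1) Omu) O'e.
    by have [] := derive_slice1 0 dG'.
  have nO : \forall a \near e, O (a, y) by apply: near_slice1 => //; exact: UO.
  have lin : \forall a \near e, forall (c : R) u z,
      'D_(c *: u + z, 0) F (a, y) = c *: 'D_(u, 0) F (a, y) + 'D_(z, 0) F (a, y).
    near=> a => c u z.
    have dFa : differentiable F (a, y).
      by apply: (Cinfty_differentiable OF); near: a; exact: nO.
    have -> : (c *: u + z, 0) = c *: (u, 0 : Y) + (z, 0).
      have -> : c *: (u, 0 : Y) + (z, 0) = (c *: u + z, c *: 0 + 0) by [].
      by rewrite scaler0 addr0.
    by rewrite (derive_linearP _ _ _ dFa).
  have dPhi u : differentiable (fun a => 'D_(u, 0) F (a, y)) e.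
    by have [] := derive_slice1 0 (dG u 0).
  have [_ E] := @derive_linear_family R _ _ _ (fun a u => 'D_(u, 0) F (a, y))
    (linv w1) e v1 lin dPhi dlinv.
  by apply: etrans E _; rewrite linv1.
(* The second derivative of [F] along the group directions is symmetric, so it drops out of the
   difference of the two instances of [main]. *)
have S := Cinfty_derive_sym (w, 0) (v, 0) oO OF (UO Uy).
have cancel (s1 s2 p q r t : Y) : s1 + p = r -> s2 + q = t -> s1 = s2 -> p - q = r - t.
  by move=> <- <- ->; rewrite opprD addrACA subrr add0r.
apply: etrans (cancel _ _ _ _ _ _ (main v w) (main w v) S).
exact: fundB.
Unshelve. all: by end_near. Qed.
End FundamentalFields.

(** * Between R^(4n) and H^n: derivatives of quaternion-valued functions *)

Section Transport.
Variables (R : realType) (n : nat).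
Notation H := (quat R).
Notation V := 'cV[quat R]_n.
Notation Y := 'rV[R]_(4 * n).

Definition of_Hn (h : V) : Y := mxvec (\matrix_(r < 4, i < n)
  (if r == inord 0 then q0 (h i 0) else if r == inord 1 then q1 (h i 0)
   else if r == inord 2 then q2 (h i 0) else q3 (h i 0))).

Let ord4 (r s : nat) : (r < 4)%N -> (s < 4)%N -> ((inord r : 'I_4) == inord s) = (r == s).
Proof. by move=> r4 s4; rewrite -val_eqE /= !inordK. Qed.

Lemma of_HnK : cancel of_Hn (@to_Hn R n).
Proof.
move=> h; apply/matrixP => i j; rewrite ord1 /to_Hn /of_Hn mxvecK !mxE !ord4//=.
by case: (h i 0).
Qed.

Lemma to_HnK : cancel (@to_Hn R n) of_Hn.
Proof.
move=> y; rewrite -[RHS]vec_mxK /of_Hn; congr mxvec; apply/matrixP => r i.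
rewrite /to_Hn !mxE /=.
have -> : r = inord r by apply: val_inj; rewrite /= inordK.
by case: r => [[|[|[|[|//]]]]] r4 /=; rewrite !ord4//= inordK.
Qed.

Lemma to_HnP c u v : to_Hn (c *: u + v : Y) = to_Hn u *q realq c + to_Hn v.
Proof.
apply/matrixP => i j; rewrite ord1 [RHS]mxE rscalE /to_Hn !linearP !mxE.
by apply: quatP; rewrite ?qE /=; ring.
Qed.

Lemma to_HnD u v : to_Hn (u + v : Y) = to_Hn u + to_Hn v.
Proof. by rewrite -[u in LHS]scale1r to_HnP realq1 rscal1. Qed.

Lemma to_Hn0 : to_Hn (0 : Y) = 0.
Proof. by apply: (addrI (to_Hn 0)); rewrite -to_HnD !addr0. Qed.

Lemma to_HnZ c u : to_Hn (c *: u : Y) = to_Hn u *q realq c.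
Proof. by rewrite -[_ *: u]addr0 to_HnP to_Hn0 addr0. Qed.

Lemma to_HnN u : to_Hn (- u : Y) = - to_Hn u.
Proof. by rewrite -scaleN1r to_HnZ realqN1 rscalNr rscal1. Qed.

Lemma to_HnB u v : to_Hn (u - v : Y) = to_Hn u - to_Hn v.
Proof. by rewrite to_HnD to_HnN. Qed.

Lemma of_HnD h k : of_Hn (h + k) = of_Hn h + of_Hn k.
Proof. by apply: (can_inj to_HnK); rewrite to_HnD !of_HnK. Qed.

Lemma of_HnZ h c : of_Hn (h *q realq c) = c *: of_Hn h.
Proof. by apply: (can_inj to_HnK); rewrite to_HnZ !of_HnK. Qed.

Lemma conjqM (x y : H) : conjq (x * y) = conjq y * conjq x.
Proof. by apply: quatP; rewrite ?qE /=; ring. Qed.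

Lemma mul_conjq (x : H) : x * conjq x = conjq x * x.
Proof. by apply: quatP; rewrite ?qE /=; ring. Qed.

Lemma conjq_real (x : H) : exists r, conjq x * x = realq r.
Proof. by eexists; exact: conjq_mul. Qed.

(** The conjugate of q is |q|^2 times its inverse, so both sides equal |y|^2 |q|^2 x a q. *)
Lemma conj_transport (x y a q : H) :
  conjq (y * q) * (y * q) * (x * a * q) = x * q * (conjq (y * q) * (y * a * q)).
Proof.
have [s Es] := conjq_real q; have [t Et] := conjq_real y.
have N : conjq (y * q) * (y * q) = realq (s * t).
  by rewrite conjqM -mulrA (mulrA (conjq y)) Et realqC mulrA Es realqM.
have qZ z : q * (conjq q * z) = realq s * z by rewrite mulrA mul_conjq Es.
have yZ z : conjq y * (y * z) = realq t * z by rewrite mulrA Et.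
rewrite N conjqM -[RHS]mulrA -(mulrA (conjq q)) -(mulrA y) yZ qZ.
by rewrite (mulrA (realq s)) -realqM !(realqC (s * t)) !mulrA.
Qed.

(* If Q h = A h q then Q (h a) = Q h (q^-1 a q); eliminating q through p = Q e turns
   this into a polynomial identity in Q, which can be differentiated. *)
Lemma GLnH_Hstar_entries (P : 'M[R]_(4 * n)) (e : V) (i0 : 'I_n) : GLnH_Hstar P ->
  let Q h := to_Hn (of_Hn h *m P) in let p := Q e i0 0 in
  forall h a i, conjq p * p * Q (h *q a) i 0 = Q h i 0 * (conjq p * Q (e *q a) i0 0).
Proof.
move=> [A [B [q [_ _ _ PE]]]] Q p h a i.
have key (T : V -> V) (L : V -> 'I_n -> H) : (forall k j, T k j 0 = L k j * q) ->
    (forall k j, L (k *q a) j = L k j * a) ->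
    conjq (T e i0 0) * T e i0 0 * T (h *q a) i 0 =
    T h i 0 * (conjq (T e i0 0) * T (e *q a) i0 0).
  by move=> TE LE; rewrite !TE !LE; exact: conj_transport.
apply: (key Q (fun k j => (A *m k) j 0)) => k j; first by rewrite /Q PE of_HnK mxE.
by rewrite mulmxA rscalE.
Qed.

Lemma to_Hn_entry (y : Y) i : to_Hn y i 0 =
  Quat (y 0 (mxvec_index (inord 0) i)) (y 0 (mxvec_index (inord 1) i))
       (y 0 (mxvec_index (inord 2) i)) (y 0 (mxvec_index (inord 3) i)).
Proof. by rewrite !mxE. Qed.
End Transport.

Section QuaternionDerivatives.
Variables (R : realType) (E : normedModType R).
Notation H := (quat R).
Implicit Types (f g : E -> H) (x v : E).

(** Differentiation is coordinatewise, and products keep their order, as noncommutativity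
    requires. *)
Definition is_qderive x v f (df : H) :=
  [/\ is_derive x v (fun y => q0 (f y)) (q0 df), is_derive x v (fun y => q1 (f y)) (q1 df),
      is_derive x v (fun y => q2 (f y)) (q2 df) & is_derive x v (fun y => q3 (f y)) (q3 df)].

Lemma is_qderive_eq x v f g df dg : (\forall y \near x, f y = g y) ->
  is_qderive x v f df -> is_qderive x v g dg -> df = dg.
Proof.
move=> fg [f0 f1 f2 f3] [g0 g1 g2 g3]; apply: quatP.
- rewrite -(@derive_val _ _ _ _ _ _ _ f0) -(@derive_val _ _ _ _ _ _ _ g0).
  by apply: near_eq_derive; apply: filterS fg => y ->.
- rewrite -(@derive_val _ _ _ _ _ _ _ f1) -(@derive_val _ _ _ _ _ _ _ g1).
  by apply: near_eq_derive; apply: filterS fg => y ->.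
- rewrite -(@derive_val _ _ _ _ _ _ _ f2) -(@derive_val _ _ _ _ _ _ _ g2).
  by apply: near_eq_derive; apply: filterS fg => y ->.
- rewrite -(@derive_val _ _ _ _ _ _ _ f3) -(@derive_val _ _ _ _ _ _ _ g3).
  by apply: near_eq_derive; apply: filterS fg => y ->.
Qed.

Lemma is_qderive_cst x v a : is_qderive x v (cst a) 0.
Proof. by split; exact: is_derive_cst. Qed.

Lemma is_qderiveD x v f g df dg : is_qderive x v f df -> is_qderive x v g dg ->
  is_qderive x v (fun y => f y + g y) (df + dg).
Proof.
by move=> [f0 f1 f2 f3] [g0 g1 g2 g3]; split; exact: is_deriveD.
Qed.

Lemma is_qderiveM x v f g df dg : is_qderive x v f df -> is_qderive x v g dg ->
  is_qderive x v (fun y => f y * g y) (df * g x + f x * dg).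
Proof.
have M (a b : E -> R) da db : is_derive x v a da -> is_derive x v b db ->
    is_derive x v (fun y => a y * b y) (da * b x + a x * db).
  move=> ha hb; apply: (is_derive_eq (is_deriveM ha hb)).
  by rewrite addrC mulrC.
move=> [f0 f1 f2 f3] [g0 g1 g2 g3]; split; rewrite ?qE.
- apply: (is_derive_eq (is_deriveB (is_deriveB (is_deriveB (M _ _ _ _ f0 g0)
    (M _ _ _ _ f1 g1)) (M _ _ _ _ f2 g2)) (M _ _ _ _ f3 g3))); ring.
- apply: (is_derive_eq (is_deriveB (is_deriveD (is_deriveD (M _ _ _ _ f0 g1)
    (M _ _ _ _ f1 g0)) (M _ _ _ _ f2 g3)) (M _ _ _ _ f3 g2))); ring.
- apply: (is_derive_eq (is_deriveD (is_deriveD (is_deriveB (M _ _ _ _ f0 g2)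
    (M _ _ _ _ f1 g3)) (M _ _ _ _ f2 g0)) (M _ _ _ _ f3 g1))); ring.
- apply: (is_derive_eq (is_deriveD (is_deriveB (is_deriveD (M _ _ _ _ f0 g3)
    (M _ _ _ _ f1 g2)) (M _ _ _ _ f2 g1)) (M _ _ _ _ f3 g0))); ring.
Qed.

Lemma is_qderive_conj x v f df : is_qderive x v f df ->
  is_qderive x v (fun y => conjq (f y)) (conjq df).
Proof.
by move=> [f0 f1 f2 f3]; split => //=; exact: is_deriveN.
Qed.

Lemma is_qderive_entry n (G : E -> 'rV[R]_(4 * n)) x v i : differentiable G x ->
  is_qderive x v (fun y => to_Hn (G y) i 0) (to_Hn ('D_v G x) i 0).
Proof.
move=> dG; have D j : is_derive x v (fun y => G y 0 j) ('D_v G x 0 j).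
  by rewrite -derive_entry//; exact/derivableP/diff_derivable/differentiable_entry.
have E0 : (fun y => to_Hn (G y) i 0) = (fun y =>
  Quat (G y 0 (mxvec_index (inord 0) i)) (G y 0 (mxvec_index (inord 1) i))
       (G y 0 (mxvec_index (inord 2) i)) (G y 0 (mxvec_index (inord 3) i))).
  by apply/funext => y; exact: to_Hn_entry.
by rewrite E0 to_Hn_entry; split; exact: D.
Qed.
End QuaternionDerivatives.

(** * Fields with derivative in gl(n,H) + H are projective *)

Section QuaternionicFields.
Variables (R : realType) (n : nat) (i0 : 'I_n).
Notation H := (quat R).
Notation V := 'cV[quat R]_n.
Notation Y := 'rV[R]_(4 * n).
Notation e0 := (delta_mx i0 0 : V).
Implicit Types (X : Y -> Y) (h k : V).

Definition DH X y h : V := to_Hn ('D_(of_Hn h) X y).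

Lemma DH_real_linear X y : differentiable X y -> real_linear (DH X y).
Proof.
move=> dX; split=> [h k|r h]; rewrite /DH.
  by rewrite of_HnD derive_dirD// to_HnD.
by rewrite of_HnZ derive_dirZ// to_HnZ.
Qed.

Lemma is_qderiveB (E : normedModType R) (f g : E -> H) x v df dg :
  is_qderive x v f df -> is_qderive x v g dg ->
  is_qderive x v (fun y => f y - g y) (df - dg).
Proof. by move=> [f0 f1 f2 f3] [g0 g1 g2 g3]; split; exact: is_deriveB. Qed.

Lemma is_qderiveMr (E : normedModType R) (f : E -> H) x v df a :
  is_qderive x v f df -> is_qderive x v (fun y => f y * a) (df * a).
Proof.
by move=> qf; have := is_qderiveM qf (is_qderive_cst x v a); rewrite mulr0 addr0.
Qed.

Lemma is_qderiveMl (E : normedModType R) (f : E -> H) x v df a :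
  is_qderive x v f df -> is_qderive x v (fun y => a * f y) (a * df).
Proof.
by move=> qf; have := is_qderiveM (is_qderive_cst x v a) qf; rewrite mul0r add0r.
Qed.

Lemma gl_plus_H_entries (D : V -> V) :
  gl_plus_H i0 D <-> forall h a i, D (h *q a) i 0 =
    D h i 0 * a + h i 0 * (D (e0 *q a) i0 0 - D e0 i0 0 * a).
Proof.
split=> [DH h a i|DH h a]; first by rewrite DH mxE !rscalE.
by apply/matrixP => i j; rewrite ord1 DH [RHS]mxE !rscalE.
Qed.

(** For fixed [h] and [a] the condition is linear in the differential with constant coefficients, so
    it can be differentiated along [l]; exchanging derivatives turns the result into the condition
    for ['D_l X]. *)
Lemma gl_plus_H_derive X (U : set Y) l y : open U -> Cinfty U X ->
  (forall y, U y -> gl_plus_H i0 (DH X y)) -> U y -> gl_plus_H i0 (DH ('D_l X) y).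
Proof.
move=> oU UX XH Uy; apply/gl_plus_H_entries => h a i.
have Q k j : is_qderive y l (fun z => DH X z k j 0) (DH ('D_l X) y k j 0).
  have dk := Cinfty_differentiable (Cinfty_derive (of_Hn k) UX) Uy.
  have := is_qderive_entry l j dk.
  by rewrite (Cinfty_derive_sym (of_Hn k) l oU UX Uy).
have Q2 := is_qderiveD (is_qderiveMr a (Q h i))
  (is_qderiveMl (h i 0) (is_qderiveB (Q (e0 *q a) i0) (is_qderiveMr a (Q e0 i0)))).
apply: (is_qderive_eq _ (Q (h *q a) i) Q2).
have nU : nbhs y U by exact: open_nbhs_nbhs.
apply: filterS nU => z Uz; exact: ((gl_plus_H_entries _).1 (XH z Uz) h a i).
Qed.
End QuaternionicFields.

Section FundamentalFieldsQuaternionic.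
Variables (R : realType) (d n : nat) (i0 : 'I_n).
Notation H := (quat R).
Notation V := 'cV[quat R]_n.
Notation A := 'rV[R]_d.
Notation Y := 'rV[R]_(4 * n).
Notation e0 := (delta_mx i0 0 : V).

(** The hypothesis is the derivative of the identity of [GLnH_Hstar_entries] at the identity matrix,
    with [p], [D1], [D2], [D3] the derivatives of its four entries. Since p plus its conjugate is
    real, it moves past [x] and cancels. *)
Lemma cancel_real_part (p x a D1 D2 D3 : H) :
  (conjq p * 1 + conjq 1 * p) * (x * a) + conjq 1 * 1 * D1 =
    D2 * (conjq 1 * (1 * a)) + x * (conjq p * (1 * a) + conjq 1 * D3) ->
  D1 = D2 * a + x * (D3 - p * a).
Proof.
have -> : conjq 1 = 1 :> H by apply: quatP; rewrite //= oppr0.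
rewrite !mulr1 !mul1r.
have -> : conjq p = realq (q0 p + q0 p) - p by apply: quatP; rewrite ?qE /=; ring.
set r := realq _ => E; apply: (addrI (r * (x * a))).
move: E; rewrite subrK => ->.
have -> : (r - p) * a + D3 = r * a + (D3 - p * a).
  by rewrite mulrBl -addrA [- _ + _]addrC.
by rewrite mulrDr mulrA -realqC -mulrA addrCA.
Qed.

(** The Jacobians of the slices satisfy a polynomial identity for [a] near [e] and are trivial at
    [a = e]. Differentiating in [a] along [v], with the derivatives of [F] exchanged, yields the
    differential of [fund F e v]. *)
Lemma fund_gl_plus_H (F : A * Y -> Y) (O : set (A * Y)) (e : A) (U : set Y) :
  open O -> Cinfty O F -> (forall y, U y -> O (e, y)) ->
  (forall y, U y -> F (e, y) = y) -> open U ->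
  (forall y, U y -> \forall a \near e, GLnH_Hstar (jacobian (fun z => F (a, z)) y)) ->
  forall v y, U y -> gl_plus_H i0 (DH (fund F e v) y).
Proof.
move=> oO OF UO F1 oU FJ v y Uy; apply/gl_plus_H_entries => h a i.
pose Q (b : A) (k : V) := to_Hn ('D_(0, of_Hn k) F (b, y)).
have OE := UO _ Uy.
have nO : \forall b \near e, O (b, y) by exact: near_slice1.
have id : \forall b \near e, forall h a i,
    conjq (Q b e0 i0 0) * Q b e0 i0 0 * Q b (h *q a) i 0 =
    Q b h i 0 * (conjq (Q b e0 i0 0) * Q b (e0 *q a) i0 0).
  have nJ := FJ _ Uy.
  near=> b.
  have dF : differentiable F (b, y).
    by apply: (Cinfty_differentiable OF); near: b; exact: nO.
  have QE k : Q b k = to_Hn (of_Hn k *m jacobian (fun z => F (b, z)) y).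
    have [dS E] := derive_slice2 (of_Hn k) dF.
    by rewrite /Q -E deriveEjacobian.
  move=> h' a' i'; rewrite !QE.
  apply: (GLnH_Hstar_entries e0 i0 _ h' a' i'); near: b; exact: nJ.
have Q0 k : Q e k = k.
  rewrite /Q; have dF := Cinfty_differentiable OF OE.
  have [_ <-] := derive_slice2 (of_Hn k) dF.
  rewrite (_ : 'D__ _ _ = of_Hn k) ?of_HnK// -[RHS](derive_id y (of_Hn k)).
  apply: near_eq_derive.
  have nU : nbhs y U by exact: open_nbhs_nbhs.
  by apply: filterS nU => z /F1.
have D k j : is_qderive e v (fun b => Q b k j 0) (DH (fund F e v) y k j 0).
  have dk := Cinfty_differentiable (Cinfty_derive (0, of_Hn k) OF) OE.
  have [ds Es] := derive_slice1 v dk.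
  have := is_qderive_entry v j ds; rewrite Es (Cinfty_derive_sym _ _ oO OF OE).
  have dv := Cinfty_differentiable (Cinfty_derive (v, 0) OF) OE.
  by have [_ <-] := derive_slice2 (of_Hn k) dv.
have L := is_qderiveM (is_qderiveM (is_qderive_conj (D e0 i0)) (D e0 i0)) (D (h *q a) i).
have S := is_qderiveM (D h i) (is_qderiveM (is_qderive_conj (D e0 i0)) (D (e0 *q a) i0)).
have {}id : \forall b \near e, conjq (Q b e0 i0 0) * Q b e0 i0 0 * Q b (h *q a) i 0 =
    Q b h i 0 * (conjq (Q b e0 i0 0) * Q b (e0 *q a) i0 0).
  by near=> b; near: b; apply: filterS id => b; exact.
have := is_qderive_eq id L S; rewrite !Q0 !rscalE.
have -> : e0 i0 0 = 1 by rewrite mxE !eqxx.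
exact: cancel_real_part.
Unshelve. all: by end_near. Qed.
End FundamentalFieldsQuaternionic.

Section ProjectiveForm.
Variables (R : realType) (n : nat) (i0 : 'I_n).
Notation H := (quat R).
Notation V := 'cV[quat R]_n.
Notation Y := 'rV[R]_(4 * n).
Implicit Types (X : Y -> Y) (h k : V).

(** Subtracting right multiplication by [rotpart] leaves a map commuting with all right
    multiplications, hence a matrix. *)
Lemma gl_plus_H_split (D : V -> V) : real_linear D -> gl_plus_H i0 D ->
  exists (A : 'M[H]_n) (q : H), forall h, D h = A *m h + h *q q.
Proof.
move=> Dl DH; pose q := rotpart i0 D; pose B h := D h - h *q q.
have [DD _] := Dl.
have BD h k : B (h + k) = B h + B k by rewrite /B DD mulmxDl opprD addrACA.
have BZ h a : B (h *q a) = B h *q a.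
  have ab (d x y : V) : d + (x - y) - x = d - y by rewrite addrA addrAC addrK.
  by rewrite /B (gl_plus_HE _ _ Dl DH) mulmxBl !rscalA rscalBr ab.
exists (\matrix_(i, j) B (delta_mx j 0) i 0), q => h.
rewrite -[LHS](subrK (h *q q)); congr (_ + _); rewrite -/(B h).
clearbody B; have B0 : B 0 = 0 by rewrite -(rscal0 0) BZ !rscal0.
rewrite {1}(col_basis h) (big_morph B BD B0); apply/matrixP => i j; rewrite ord1.
rewrite summxE [RHS]mxE; apply: eq_bigr => l _.
by rewrite BZ rscalE mxE.
Qed.

Lemma realq_half : realq 2^-1 + realq 2^-1 = 1 :> H.
Proof. by rewrite -realqD (_ : 2^-1 + 2^-1 = 1 :> R) //; field. Qed.

Lemma quaternionic_field_third_derivative X (U : set Y) : open U -> Cinfty U X ->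
  (forall y, U y -> gl_plus_H i0 (DH X y)) ->
  forall y u v w, U y -> 'D_w ('D_v ('D_u X)) y = 0.
Proof.
move=> oU UX XH y u v w Uy.
have UX1 a := Cinfty_derive a UX.
pose T l h k : V := to_Hn ('D_(of_Hn k) ('D_(of_Hn h) ('D_(of_Hn l) X)) y).
have H1 a z : U z -> gl_plus_H i0 (DH ('D_a X) z) by exact: gl_plus_H_derive oU UX XH.
have H2 a b z : U z -> gl_plus_H i0 (DH ('D_b ('D_a X)) z).
  exact: gl_plus_H_derive oU (UX1 a) (H1 a).
(* Third derivatives are symmetric, and in the last argument they inherit the condition by two
   applications of [gl_plus_H_derive]. *)
have : T (to_Hn u) (to_Hn v) (to_Hn w) = 0.
  apply: (@second_prolongation _ _ i0 T) => [l h k|l h k|l h|l h].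
  - apply: (congr1 (@to_Hn R n)); apply: near_eq_derive.
    have nU : nbhs y U by exact: open_nbhs_nbhs.
    apply: filterS nU => z Uz; exact: Cinfty_derive_sym oU UX Uz.
  - apply: (congr1 (@to_Hn R n)); exact: Cinfty_derive_sym oU (UX1 _) Uy.
  - apply: DH_real_linear.
    exact: Cinfty_differentiable (Cinfty_derive (of_Hn h) (UX1 (of_Hn l))) Uy.
  - exact: H2 Uy.
by rewrite /T !to_HnK => /(congr1 (@of_Hn R n)); rewrite to_HnK -to_Hn0 to_HnK.
Qed.

Lemma quaternionic_field_projective X (U : set Y) y0 r : open U -> Cinfty U X ->
  (forall y, U y -> gl_plus_H i0 (DH X y)) -> 0 < r -> ball y0 r `<=` U ->
  exists M : 'M[H]_(n + 1), real_trace M = 0 /\ forall y, ball y0 r y ->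
    to_Hn (X y) = proj_field M (to_Hn (y - y0)) /\
    forall w : Y, to_Hn ('D_w X y) = dproj_field M (to_Hn (y - y0)) (to_Hn w).
Proof.
move=> oU UX XH r0 rU.
have X3 := quaternionic_field_third_derivative oU UX XH.
have U0 : U y0 by apply: rU; exact: ballxx.
have UX1 a := Cinfty_derive a UX.
have [A [q DE]] := gl_plus_H_split (DH_real_linear (Cinfty_differentiable UX U0)) (XH y0 U0).
pose beta h k : V := to_Hn ('D_(of_Hn k) ('D_(of_Hn h) X) y0).
have [c betaE] : exists c : 'rV[H]_n, forall h k, beta h k = h *m (c *m k) + k *m (c *m h).
  apply: (@first_prolongation _ _ i0) => [h k|h|h].
  - apply: (congr1 (@to_Hn R n)); exact: Cinfty_derive_sym oU UX U0.
  - exact: DH_real_linear (Cinfty_differentiable (UX1 _) U0).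
  - exact: gl_plus_H_derive oU UX XH U0.
have [M [trM ME dME]] := traceless_representative
  (block_mx A (to_Hn (X y0)) (- c) (- q%:M)).
exists M; split=> // y yb.
have [dX Xy] := quadratic_expansion oU UX X3 r0 rU yb.
have DXE (k : Y) : to_Hn ('D_k X y0) = A *m to_Hn k + to_Hn k *q q.
  by rewrite -DE /DH to_HnK.
have bE (k l : Y) : to_Hn ('D_k ('D_l X) y0) =
    to_Hn l *m (c *m to_Hn k) + to_Hn k *m (c *m to_Hn l).
  by rewrite -betaE /beta !to_HnK.
split=> [|k].
  have [E1 E2] := (DXE (y - y0), bE (y - y0) (y - y0)).
  rewrite -ME proj_field_block Xy (to_HnD (_ + _)) (to_HnD (X y0)) to_HnZ E1 E2.
  (* On the diagonal the second derivative is 2 h c h; the Taylor factor 1/2 leaves h c h. *)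
  by rewrite addrA mulmxDl -rscalDr realq_half rscal1.
rewrite -dME dproj_field_block dX (to_HnD ('D_k X y0)) DXE bE.
by congr (_ + _); exact: addrC.
Qed.
End ProjectiveForm.

Section LocalRepresentation.
Variables (R : realType) (d n : nat).
Notation H := (quat R).
Notation V := 'cV[quat R]_n.
Notation A := 'rV[R]_d.
Notation Y := 'rV[R]_(4 * n).

(** This uniqueness lets linear and bracket relations pass from fields on a ball to their matrices.
    Along [h] the step r / (|h| + 1) stays inside the ball. *)
Lemma proj_field_ball_eq0 (i0 : 'I_n) (N : 'M[H]_(n + 1)) (y0 : Y) r : 0 < r ->
  real_trace N = 0 -> (forall y, ball y0 r y -> proj_field N (to_Hn (y - y0)) = 0) ->
  N = 0.
Proof.
move=> r0 trN Nb; apply: (proj_field_eq0 i0 trN) => [|h].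
  by have := Nb y0 (ballxx _ r0); rewrite subrr to_Hn0.
pose t := r / (`|of_Hn h| + 1).
have p0 : 0 < `|of_Hn h| + 1 by rewrite ltr_wpDl.
have t0 : 0 < t by rewrite divr_gt0.
have inb (s : R) : `|s| = t -> ball y0 r (y0 + s *: of_Hn h).
  move=> st; rewrite -ball_normE /= opprD addrA subrr add0r normrN normrZ st.
  by rewrite /t mulrAC ltr_pdivrMr// ltr_pM2l// ltrDl.
exists t; split; first exact: lt0r_neq0.
  have := Nb _ (inb t (gtr0_norm t0)).
  by rewrite addrC addrA addNr add0r to_HnZ of_HnK.
have := Nb _ (inb (- t) (etrans (normrN t) (gtr0_norm t0))).
by rewrite addrC addrA addNr add0r scaleNr to_HnN to_HnZ of_HnK.
Qed.

Lemma proj_field_scale c (N : 'M[H]_(n + 1)) h :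
  proj_field ((realq c)%:M *m N) h = proj_field N h *q realq c.
Proof.
rewrite /proj_field !mulmxA real_scalar_comm -!mulmxA -real_scalar_comm.
by rewrite !mulmxA.
Qed.

Lemma real_trace_scale c (N : 'M[H]_(n + 1)) :
  real_trace ((realq c)%:M *m N) = c * real_trace N.
Proof.
rewrite mul_scalar_mx /real_trace mxtraceZ.
by rewrite q0M /=; ring.
Qed.

Lemma local_representation (F : A * Y -> Y) (O : set (A * Y)) (mu : A * A -> A)
    (O' : set (A * A)) (e : A) (U : set Y) (y0 : Y) (v0 : A) :
  open O -> Cinfty O F -> open O' -> Cinfty O' mu -> open U ->
  (forall y, U y -> O (e, y)) -> (forall y, U y -> F (e, y) = y) -> O' (e, e) ->
  (\forall a \near e, mu (a, e) = a) -> (\forall b \near e, mu (e, b) = b) ->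
  (forall y, U y ->
    \forall a \near e, \forall b \near e, F (mu (a, b), y) = F (a, F (b, y))) ->
  (forall y, U y -> \forall a \near e, GLnH_Hstar (jacobian (fun z => F (a, z)) y)) ->
  U y0 -> fund F e v0 y0 <> 0 ->
  exists rho : A -> 'M[H]_(n + 1),
    [/\ forall c v w, rho (c *: v + w) = (realq c)%:M *m rho v + rho w,
        forall v w, rho ('D_v (linv mu e w) e - 'D_w (linv mu e v) e) =
          rho v *m rho w - rho w *m rho v &
        exists v, rho v <> 0].
Proof.
move=> oO OF oO' Omu oU UO F1 O'e mu1r mu1l FA FJ U0 nz.
(* A nonzero vector of R^(4n) forces n > 0, which supplies the index [i0] at which defects are
   read. *)
have n0 : (0 < n)%N.
  rewrite lt0n; apply/eqP => n0; apply: nz; apply/rowP => j.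
  by have := ltn_ord j; rewrite {2}n0.
pose i0 := Ordinal n0.
have [r r0 rU] : exists2 r, 0 < r & ball y0 r `<=` U.
  have /nbhs_ballP[r /= r0 rU] : nbhs y0 U by exact: open_nbhs_nbhs.
  by exists r.
have fC v : Cinfty U (fund F e v) := fund_Cinfty oO OF UO v.
have fH v y : U y -> gl_plus_H i0 (DH (fund F e v) y).
  exact: fund_gl_plus_H oO OF UO F1 oU FJ v y.
have [M ME] : exists M : A -> 'M[H]_(n + 1), forall v,
    real_trace (M v) = 0 /\ forall y, ball y0 r y ->
    to_Hn (fund F e v y) = proj_field (M v) (to_Hn (y - y0)) /\
    forall w : Y, to_Hn ('D_w (fund F e v) y) = dproj_field (M v) (to_Hn (y - y0)) (to_Hn w).
  pose P v := cid (quaternionic_field_projective oU (fC v) (fH v) r0 rU).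
  by exists (fun v => sval (P v)) => v; exact: svalP (P v).
have trM v : real_trace (M v) = 0 by have [] := ME v.
have fM v y (yb : ball y0 r y) : to_Hn (fund F e v y) = proj_field (M v) (to_Hn (y - y0)).
  by have [_ /(_ y yb)[]] := ME v.
have dfM v y (yb : ball y0 r y) w : to_Hn ('D_w (fund F e v) y) =
    dproj_field (M v) (to_Hn (y - y0)) (to_Hn w).
  by have [_ /(_ y yb)[]] := ME v.
exists M; split=> [c v w|v w|].
- apply/eqP; rewrite -subr_eq0; apply/eqP.
  apply: (proj_field_ball_eq0 (y0 := y0) i0 r0) => [|y yb].
    by rewrite real_traceB real_traceD real_trace_scale !trM mulr0 addr0 subrr.
  rewrite proj_fieldB proj_fieldD proj_field_scale -!(fM _ _ yb).
  by rewrite (fund_linear OF UO _ _ _ (rU _ yb)) to_HnP subrr.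
- apply/eqP; rewrite -subr_eq0; apply/eqP.
  apply: (proj_field_ball_eq0 (y0 := y0) i0 r0) => [|y yb].
    by rewrite !real_traceB [X in _ - (X - _)]real_traceC trM !subrr.
  rewrite proj_fieldB -proj_field_bracket -!(fM _ _ yb) -!(dfM _ _ yb).
  by rewrite (fund_bracket oO OF oO' Omu UO F1 O'e mu1r mu1l FA _ _ (rU _ yb)) to_HnB subrr.
- exists v0 => M0; apply: nz; apply: (can_inj (@to_HnK R n)).
  by rewrite (fM _ _ (ballxx _ r0)) M0 /proj_field mulmx0 mul0mx to_Hn0.
Qed.
End LocalRepresentation.

(** * Charts and the action *)

Section Charts.
Variable R : realType.

(** [is_chart] makes only the full image open; smaller images are handled by continuity of
    [chart_inv] there. *)
Lemma open_chart_image (T : topologicalType) (E : normedModType R) (phi : chart T E)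
    (W : set T) : is_chart phi -> open W -> open (phi @` (chart_dom phi `&` W)).
Proof.
move=> [od oi K _ ci] oW; rewrite openE => _ [x [dx Wx] <-].
have nW : nbhs (chart_inv phi (phi x)) W by rewrite K//; exact: open_nbhs_nbhs.
have ni : nbhs (phi x) (phi @` chart_dom phi).
  by apply: open_nbhs_nbhs; split=> //; exists x.
have c : nbhs (phi x) (chart_inv phi @^-1` W) := ci _ (imageP _ dx) _ nW.
rewrite /interior; apply: filterS2 ni c => z [x' dx' <-] /=.
by rewrite K// => Wx'; exists x'.
Qed.

Lemma continuous_pair_fun (T1 T2 T3 T4 : topologicalType) (f : T1 -> T2) (g : T3 -> T4)
    (p : T1 * T3) : {for p.1, continuous f} -> {for p.2, continuous g} ->
  {for p, continuous (fun q : T1 * T3 => (f q.1, g q.2))}.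
Proof.
move=> cf cg; apply: cvg_pair => /=.
  by apply: (@continuous_comp _ _ _ fst f) => //; exact: cvg_fst.
by apply: (@continuous_comp _ _ _ snd g) => //; exact: cvg_snd.
Qed.

Lemma open_prod (T T' : topologicalType) (A : set T) (B : set T') :
  open A -> open B -> open (A `*` B).
Proof.
move=> oA oB; rewrite openE => -[x y] [/= Ax By]; exists (A, B) => //=.
by split; apply: open_nbhs_nbhs.
Qed.

Lemma is_chart_prod (T T' : topologicalType) (E E' : normedModType R)
    (phi : chart T E) (psi : chart T' E') :
  is_chart phi -> is_chart psi -> is_chart (prod_chart phi psi).
Proof.
move=> [od oi K c ci] [od' oi' K' c' ci'].
have im : prod_chart phi psi @` chart_dom (prod_chart phi psi) =
    (phi @` chart_dom phi) `*` (psi @` chart_dom psi).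
  apply/seteqP; split=> [_ [[x y] [/= dx dy] <-]|[_ _] [/= [x dx <-] [y dy <-]]].
    by split; [exists x|exists y].
  by exists (x, y).
split.
- exact: open_prod.
- by rewrite im; exact: open_prod.
- by move=> [x y] [/= dx dy]; rewrite K// K'.
- by move=> [x y] [/= dx dy]; apply: continuous_pair_fun; [exact: c|exact: c'].
- move=> y; rewrite im => -[/= hx hy]; apply: continuous_pair_fun; [exact: ci|exact: ci'].
Qed.

Lemma smooth_in_charts_differentiable (T T' : topologicalType) (E E' : normedModType R)
    (f : T -> T') (phi : chart T E) (psi : chart T' E') x :
  smooth_in_charts f phi psi -> chart_dom phi x -> chart_dom psi (f x) ->
  differentiable (psi \o f \o chart_inv phi) (phi x).
Proof.
move=> fs dx dfx; apply: (Cinfty_differentiable fs).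
by exists x.
Qed.

Lemma chart_at_atlas d (M : manifold R d) (x : M) :
  atlas (chart_at x) /\ chart_dom (chart_at x) x.
Proof. exact: svalP (cid (atlas_cover x)). Qed.

Lemma chart_imageK (T : topologicalType) (E : normedModType R) (phi : chart T E) x :
  is_chart phi -> chart_dom phi x -> chart_inv phi (phi x) = x.
Proof. by move=> [_ _ K _ _]; exact: K. Qed.

Lemma near_chart_inv (T : topologicalType) (E : normedModType R) (phi : chart T E) x
    (W : set T) : is_chart phi -> chart_dom phi x -> open W -> W x ->
  \forall z \near phi x, [/\ chart_dom phi (chart_inv phi z), phi (chart_inv phi z) = z &
    W (chart_inv phi z)].
Proof.
move=> cphi dx oW Wx; have o := open_chart_image cphi oW.
have : nbhs (phi x) (phi @` (chart_dom phi `&` W)).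
  by apply: open_nbhs_nbhs; split=> //; exists x.
by apply: filterS => _ [x' [dx' Wx'] <-]; rewrite (chart_imageK cphi dx').
Qed.

End Charts.

Section LieGroups.
Variables (R : realType) (d : nat) (G : lie_group R d).
Implicit Types g h : G.

Lemma lg_mulVr g : lg_mul g (lg_inv g) = lg_one G.
Proof.
rewrite -[lg_mul g _]lg_mul1 -{1}(lg_mulV (lg_inv g)) -lg_mulA.
by rewrite [lg_mul (lg_inv g) _]lg_mulA lg_mulV lg_mul1 lg_mulV.
Qed.

Lemma lg_mul1r g : lg_mul g (lg_one G) = g.
Proof. by rewrite -(lg_mulV g) lg_mulA lg_mulVr lg_mul1. Qed.

End LieGroups.

Section QuaternionicCharts.
Variables (R : realType) (n d : nat) (G : lie_group R d) (M : manifold R (4 * n)).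
Variables (B : almost_quaternionic M) (act : G -> M -> M).
Hypothesis hact : smooth_action act.
Hypothesis hauto : forall g : G, quaternionic_automorphism B (act g).

Lemma jacobian_comp p q m (f : 'rV[R]_p -> 'rV[R]_q) (g : 'rV[R]_q -> 'rV[R]_m) x :
  differentiable f x -> differentiable g (f x) ->
  jacobian (g \o f) x = jacobian f x *m jacobian g (f x).
Proof.
move=> df dg; apply/row_matrixP => i; rewrite !rowE mulmxA.
rewrite -(deriveEjacobian _ (differentiable_comp df dg)) -(deriveEjacobian _ df).
by rewrite -(deriveEjacobian _ dg) derive_comp.
Qed.

Lemma jacobian_near p q (f g : 'rV[R]_p -> 'rV[R]_q) x :
  (\forall y \near x, f y = g y) -> differentiable f x -> jacobian f x = jacobian g x.
Proof.
move=> fg df; have dg := differentiable_near fg df.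
apply/matrixP => i j.
have E h (dh : differentiable h x) : jacobian h x i j = 'D_(delta_mx 0 i) h x 0 j.
  by rewrite (deriveE _ dh) /jacobian mxE.
apply: etrans (E f df) (etrans _ (esym (E g dg))).
by rewrite (near_eq_derive _ fg).
Qed.

Definition adapted (psi : chart M 'rV[R]_(4 * n)) :=
  atlas psi /\ forall y, chart_dom psi y -> B y (coordinate_frame psi y).

Lemma open_act_preimage g (W : set M) : open W -> open [set x | W (act g x)].
Proof.
move=> oW; have [[[cg _] _] _] := hauto g.
by apply: open_comp oW => x _; exact: cg.
Qed.

(** By the chain rule, the Jacobian times the frame at [act g x] is the transported frame of [x].
    That frame lies in [B], hence in the orbit of the frame at [act g x], and this invertible frame
    can be cancelled. *)
Lemma act_jacobian (psi : chart M 'rV[R]_(4 * n)) g x : adapted psi ->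
  chart_dom psi x -> chart_dom psi (act g x) ->
  GLnH_Hstar (jacobian (psi \o act g \o chart_inv psi) (psi x)).
Proof.
move=> [apsi Bpsi] dx dgx; have [[[_ sg] _] autg] := hauto g.
have [ac1 dc1] := chart_at_atlas x; have [ac2 dc2] := chart_at_atlas (act g x).
have cpsi := atlas_chart apsi; have cc1 := atlas_chart ac1; have cc2 := atlas_chart ac2.
have [opsi _ _ _ _] := cpsi; have [oc1 _ _ _ _] := cc1; have [oc2 _ _ _ _] := cc2.
have d1 : differentiable (chart_at x \o chart_inv psi) (psi x).
  exact: (smooth_in_charts_differentiable (atlas_compat apsi ac1) dx dc1).
have d2 : differentiable (chart_at (act g x) \o act g \o chart_inv (chart_at x))
    (chart_at x x).
  exact: (smooth_in_charts_differentiable (sg _ _ ac1 ac2) dc1 dc2).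
have d3 : differentiable (chart_at (act g x) \o chart_inv psi) (psi (act g x)).
  exact: (smooth_in_charts_differentiable (atlas_compat apsi ac2) dgx dc2).
have d4 : differentiable (psi \o act g \o chart_inv psi) (psi x).
  exact: (smooth_in_charts_differentiable (sg _ _ apsi apsi) dx dgx).
have Kx := chart_imageK cpsi dx.
have e1 : (chart_at x \o chart_inv psi) (psi x) = chart_at x x by rewrite /= Kx.
have e4 : (psi \o act g \o chart_inv psi) (psi x) = psi (act g x) by rewrite /= Kx.
have E : coordinate_frame psi x *m tangent_map (act g) x =
    jacobian (psi \o act g \o chart_inv psi) (psi x) *m coordinate_frame psi (act g x).
  rewrite -e1 in d2; rewrite -e4 in d3.
  have J1 := jacobian_comp d1 d2; have J2 := jacobian_comp d4 d3.
  rewrite e1 in J1; rewrite e4 in J2.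
  apply: etrans (esym J1) (etrans _ J2).
  apply: jacobian_near; last exact: differentiable_comp.
  have n1 := near_chart_inv cpsi dx oc1 dc1.
  have n2 := near_chart_inv cpsi dx (open_act_preimage g opsi) dgx.
  apply: filterS2 n1 n2 => z [_ _ z1] [_ _ z2] /=.
  by rewrite (chart_imageK cc1 z1) (chart_imageK cpsi z2).
have := (autg x _).1 (Bpsi _ dx); rewrite E => BJ.
have Bg := Bpsi _ dgx.
have [P GP EP] := (aq_orbit _ Bg).1 BJ.
suff -> : jacobian (psi \o act g \o chart_inv psi) (psi x) = P by [].
have u := aq_unit Bg.
by apply: (can_inj (mulmxK u)).
Qed.

Lemma act_prod_smooth (phi : chart G 'rV[R]_d) (psi psi' : chart M 'rV[R]_(4 * n)) :
  atlas phi -> atlas psi -> atlas psi' ->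
  let f (p : G * M) := act p.1 p.2 in
  let O := prod_chart phi psi @`
    (chart_dom (prod_chart phi psi) `&` f @^-1` chart_dom psi') in
  open O /\ Cinfty O (psi' \o f \o chart_inv (prod_chart phi psi)).
Proof.
move=> aphi apsi apsi' f O; have [_ _ [cf sf]] := hact.
split; last by apply: sf => //; exists phi, psi.
apply: open_chart_image; first exact: is_chart_prod (atlas_chart aphi) (atlas_chart apsi).
have [op _ _ _ _] := atlas_chart apsi'.
by apply: open_comp op => x _; exact: cf.
Qed.

Lemma mul_prod_smooth (phi psi chi : chart G 'rV[R]_d) :
  atlas phi -> atlas psi -> atlas chi ->
  let f (p : G * G) := lg_mul p.1 p.2 in
  let O := prod_chart phi psi @`
    (chart_dom (prod_chart phi psi) `&` f @^-1` chart_dom chi) in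
  open O /\ Cinfty O (chi \o f \o chart_inv (prod_chart phi psi)).
Proof.
move=> aphi apsi apsi' f O; have [cf sf] := lg_mul_smooth G.
split; last by apply: sf => //; exists phi, psi.
apply: open_chart_image; first exact: is_chart_prod (atlas_chart aphi) (atlas_chart apsi).
have [op _ _ _ _] := atlas_chart apsi'.
by apply: open_comp op => x _; exact: cf.
Qed.

End QuaternionicCharts.

Section FixedPoints.
Variables (R : realType) (n d : nat) (G : lie_group R d) (M : manifold R (4 * n)).
Variables (B : almost_quaternionic M) (act : G -> M -> M).
Hypothesis hB : integrable_aq B.
Hypothesis hact : smooth_action act.
Notation phi := (chart_at (lg_one G)).
Notation e := (chart_at (lg_one G) (lg_one G)).

Definition act_chart (psi : chart M 'rV[R]_(4 * n)) (p : 'rV[R]_d * 'rV[R]_(4 * n)) :=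
  psi (act (chart_inv phi p.1) (chart_inv psi p.2)).

Lemma continuous_orbit x : continuous (fun g : G => act g x).
Proof.
have [_ _ [ca _]] := hact => g.
apply: (@continuous_comp _ _ _ (fun h : G => (h, x)) (fun p : G * M => act p.1 p.2)).
  by apply: cvg_pair; [exact: cvg_id|exact: cvg_cst].
exact: ca.
Qed.

Lemma continuous_mulr (h : G) : continuous (fun g : G => lg_mul g h).
Proof.
have [cm _] := lg_mul_smooth G => g.
apply: (@continuous_comp _ _ _ (fun k : G => (k, h)) (fun p : G * G => lg_mul p.1 p.2)).
  by apply: cvg_pair; [exact: cvg_id|exact: cvg_cst].
exact: cm.
Qed.

(** Right translation by the inverse of g identifies any derivative of the orbit map at g with the
    value of a fundamental field at [act g x]. So the orbit map, read in charts, has zero derivative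
    around g0. *)
Lemma orbit_locally_constant x g0 :
  (forall psi y v, adapted B psi -> chart_dom psi y ->
     fund (act_chart psi) e v (psi y) = 0) ->
  \forall g \near g0, act g x = act g0 x.
Proof.
move=> f0; have [act1 actM _] := hact.
have [psi [apsi dp Bpsi]] := hB (act g0 x).
have adpsi : adapted B psi by [].
have [achi dchi] := chart_at_atlas g0; have [aphi dphi] := chart_at_atlas (lg_one G).
set chi := chart_at g0 in achi dchi.
have [[cchi cphi] cpsi] := (atlas_chart achi, atlas_chart aphi, atlas_chart apsi).
have [opsi _ _ _ _] := cpsi.
pose W := [set g : G | chart_dom psi (act g x)].
have oW : open W by apply: open_comp opsi => g _; exact: continuous_orbit.
pose Om := chi @` (chart_dom chi `&` W).
have oOm : open Om by exact: open_chart_image.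
pose o c := psi (act (chart_inv chi c) x).
have o_diff c w : Om c -> differentiable o c /\ 'D_w o c = 0.
  move=> [g [dg Wg] <-].
  have [aeta deta] := chart_at_atlas (lg_inv g); set eta := chart_at (lg_inv g) in aeta deta.
  have ceta := atlas_chart aeta.
  (* Near c, o c' = psi (act (phi^-1 (rho c')) q) with q = act g x and rho c = e. *)
  pose rho c' := phi (lg_mul (chart_inv chi c') (lg_inv g)).
  have Kg := chart_imageK cchi dg.
  have drho : differentiable rho (chi g).
    have [oO CO] := mul_prod_smooth achi aeta aphi.
    have dG := @Cinfty_differentiable _ _ _ _ _ (chi g, eta (lg_inv g)) CO.
    have [|dS _] := derive_slice1 0 (dG _).
      by exists (g, lg_inv g) => //; split => //=; rewrite lg_mulVr.
    have -> : rho = fun z => (phi \o (fun p : G * G => lg_mul p.1 p.2) \o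
        chart_inv (prod_chart chi eta)) (z, eta (lg_inv g)).
      by apply/funext => z; rewrite /rho /= (chart_imageK ceta deta).
    exact: dS.
  have rhog : rho (chi g) = e by rewrite /rho Kg lg_mulVr.
  pose q := act g x.
  have dF : differentiable (act_chart psi) (e, psi q).
    have [oO CO] := act_prod_smooth hact aphi apsi apsi.
    apply: (Cinfty_differentiable CO).
    by exists (lg_one G, q) => //; split => //=; rewrite act1.
  have [dS ES] := derive_slice1 ('D_w rho (chi g)) dF.
  have dS' : differentiable (fun a => act_chart psi (a, psi q)) (rho (chi g)).
    by rewrite rhog.
  have near_o : \forall c' \near chi g, ((fun a => act_chart psi (a, psi q)) \o rho) c' = o c'.
    have oV : open [set k : G | chart_dom phi (lg_mul k (lg_inv g))].
      have [ophi _ _ _ _] := cphi; apply: open_comp ophi => k _.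
      exact: continuous_mulr.
    have := near_chart_inv cchi dg oV; rewrite /= lg_mulVr => /(_ dphi).
    apply: filterS => z [_ _ zV]; rewrite /act_chart /rho /o /=.
    rewrite (chart_imageK cphi zV) (chart_imageK cpsi Wg) /q -actM.
    by rewrite -lg_mulA lg_mulV lg_mul1r.
  split; first exact: differentiable_near near_o (differentiable_comp drho dS').
  rewrite -(near_eq_derive w near_o).
  apply: etrans (derive_comp w drho dS') _; rewrite rhog.
  by apply: etrans ES _; exact: f0.
have Omg : Om (chi g0) by exists g0.
have [r /= r0 rOm] : exists2 r, 0 < r & ball (chi g0) r `<=` Om.
  have /nbhs_ballP[r /= r0 rU] : nbhs (chi g0) Om by exact: open_nbhs_nbhs.
  by exists r.
have oconst c : ball (chi g0) r c -> o c = o (chi g0).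
  apply: (@zero_derive_constant R _ _ o (chi g0) r) => [z zb|z w zb].
    by have [] := o_diff z 0 (rOm _ zb).
  by have [] := o_diff z w (rOm _ zb).
have [ochi _ _ conchi _] := cchi.
have n1 : nbhs g0 (chart_dom chi) by exact: open_nbhs_nbhs.
have n2 : nbhs g0 W by exact: open_nbhs_nbhs.
have n3 : nbhs g0 (chi @^-1` ball (chi g0) r).
  by apply: conchi => //; exact: nbhsx_ballx.
apply: filterS3 n1 n2 n3 => g dg Wg gb.
have := oconst _ gb; rewrite /o (chart_imageK cchi dg) (chart_imageK cchi dchi) => E.
by rewrite -(chart_imageK cpsi Wg) E (chart_imageK cpsi dp).
Qed.

Lemma locally_constant_component x :
  (forall g0 : G, \forall g \near g0, act g x = act g0 x) ->
  forall g, connected_component [set: G] (lg_one G) g -> act g x = x.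
Proof.
move=> lc g [C [C1 _ cC] Cg]; have [act1 _ _] := hact.
pose S := [set h : G | act h x = x].
have oS : open S.
  by rewrite openE => h Sh; apply: filterS (lc h) => k; rewrite /S /= => ->.
have oSC : open (~` S).
  by rewrite openE => h Sh; apply: filterS (lc h) => k; rewrite /S /= => ->.
(* [S] is both open and closed, and it meets the connected set [C] at the unit. *)
have : C `&` S = C.
  apply: cC; first by exists (lg_one G); split => //; exact: act1.
    by exists S.
  by exists S => //; rewrite -openC.
by move=> CS; have [] : (C `&` S) g by rewrite CS.
Qed.
End FixedPoints.

(** * Minimal representations, the Lie bracket in the chart at 1, and the bound *)

Section Conclusion.
Variable R : realType.

(** The dimensions that occur form a nonempty set of natural numbers, so one nontrivial
    representation within the bound is all that is required. *)
Lemma rho_min_exists (g : lmodType R) (br : g -> g -> g) (k : nat)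
    (V0 : vectType R[i]) (rho0 : complexification g -> 'End(V0)) :
  g_quaternionic br rho0 -> nontrivial_rep rho0 -> (real_dim V0 <= k)%N ->
  exists (V : vectType R[i]) (rho : complexification g -> 'End(V)),
    is_rho_min br rho /\ (real_dim V <= k)%N.
Proof.
move=> q0 nt0 dk.
pose P m := `[< exists (V : vectType R[i]) (rho : complexification g -> 'End(V)),
  [/\ g_quaternionic br rho, nontrivial_rep rho & \dim {:V} = m] >].
have exP : exists m, P m by exists (\dim {:V0}); apply/asboolP; exists V0, rho0.
case: (ex_minnP exP) => m /asboolP[V [rho [qr ntr dV]]] mmin.
exists V, rho; split; last first.
  rewrite /real_dim dV (leq_trans _ dk)// leq_mul2l mmin ?orbT//.
  by apply/asboolP; exists V0, rho0.
by split=> // V' rho' qr' ntr'; rewrite dV; apply: mmin; apply/asboolP; exists V', rho'.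
Qed.

End Conclusion.

Section Bracket.
Variables (R : realType) (d : nat) (G : lie_group R d).
Notation phi := (chart_at (lg_one G)).
Notation e := (chart_at (lg_one G) (lg_one G)).

Definition mul_chart (p : 'rV[R]_d * 'rV[R]_d) : 'rV[R]_d :=
  phi (lg_mul (chart_inv phi p.1) (chart_inv phi p.2)).

(** The set [O] consists of coordinates of pairs whose product stays in the chart domain; this is
    what lets [chart_inv] undo the chart in the last clause. *)
Lemma mul_chart_smooth : exists O, [/\ open O /\ Cinfty O mul_chart, O (e, e),
  (\forall a \near e, mul_chart (a, e) = a), (\forall b \near e, mul_chart (e, b) = b) &
  forall a b, O (a, b) -> [/\ phi (chart_inv phi a) = a, phi (chart_inv phi b) = b &
    chart_inv phi (mul_chart (a, b)) = lg_mul (chart_inv phi a) (chart_inv phi b)]].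
Proof.
have [aphi dphi] := chart_at_atlas (lg_one G); have cphi := atlas_chart aphi.
have [oO CO] := mul_prod_smooth aphi aphi aphi.
eexists; split; first by split; [exact: oO|exact: CO].
- by exists (lg_one G, lg_one G) => //; split => //=; rewrite lg_mul1.
- have [ophi _ _ _ _] := cphi.
  have := near_chart_inv cphi dphi ophi dphi; apply: filterS => a [_ Ka _].
  by rewrite /mul_chart /= (chart_imageK cphi dphi) lg_mul1r.
- have [ophi _ _ _ _] := cphi.
  have := near_chart_inv cphi dphi ophi dphi; apply: filterS => a [_ Ka _].
  by rewrite /mul_chart /= (chart_imageK cphi dphi) lg_mul1.
- move=> _ _ [[g h] [[/= dg dh] dgh] [<- <-]].
  rewrite /mul_chart /= (chart_imageK cphi dg) (chart_imageK cphi dh).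
  by rewrite (chart_imageK cphi dgh).
Qed.

(** [left_invariant] differentiates a function of one variable, [linv] a function of the pair. They
    are identified near [e], where [mul_chart] is differentiable, and the bracket depends only on
    germs at [e]. *)
Lemma lie_bracketE v w :
  lie_bracket G v w = 'D_v (linv mul_chart e w) e - 'D_w (linv mul_chart e v) e.
Proof.
have [N [[oO CO] Oe mu1r mu1l _]] := mul_chart_smooth.
have near_linv u : \forall a \near e, left_invariant (G := G) u a = linv mul_chart e u a.
  have nO : \forall a \near e, N (a, e) by exact: near_slice1.
  apply: filterS nO => a Oa.
  by have [_ E] := derive_slice2 u (Cinfty_differentiable CO Oa); exact: E.
have linv_e u : left_invariant (G := G) u e = u.
  apply: etrans (nbhs_singleton (near_linv u)) _; exact: linv1 CO Oe mu1l u.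
rewrite /lie_bracket !linv_e.
by rewrite (near_eq_derive v (near_linv w)) (near_eq_derive w (near_linv v)).
Qed.
End Bracket.

Theorem corollary5p1 (R : realType) (n d : nat)
    (G : lie_group R d) (M : manifold R (4 * n)) (B : almost_quaternionic M)
    (act : G -> M -> M)
    (hM : connected [set: M])
    (hB : integrable_aq B)
    (hact : smooth_action act)
    (hauto : forall g : G, quaternionic_automorphism B (act g))
    (hnontriv : exists (g : G) (x : M),
       connected_component [set: G] (lg_one G) g /\ act g x <> x) :
  exists (V : vectType R[i]) (rho : complexification (lie_algebra G) -> 'End(V)),
    is_rho_min (lie_bracket G) rho /\ (real_dim V <= 4 * n + 4)%N.
Proof.
have [psi [x0 [v0 [adpsi dx0 nz]]]] : exists psi x0 v0, [/\ adapted B psi,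
    chart_dom psi x0 & fund (act_chart act psi) (chart_at (lg_one G) (lg_one G)) v0 (psi x0) <> 0].
  apply: contrapT => no; have [g [x [gc gx]]] := hnontriv; apply: gx.
  apply: (locally_constant_component hact _ gc) => g0.
  apply: (orbit_locally_constant hB hact) => psi y v adpsi dy; apply: contrapT => nz.
  by apply: no; exists psi, y, v.
have [apsi _] := adpsi; have cpsi := atlas_chart apsi.
have [opsi oU _ _ _] := cpsi.
have [aphi dphi] := chart_at_atlas (lg_one G); have cphi := atlas_chart aphi.
have [act1 actM _] := hact.
have [N [[oN CN] Ne mu1r mu1l NK]] := mul_chart_smooth G.
have [oO CO] := act_prod_smooth hact aphi apsi apsi.
set O := (_ @` _) in oO CO.
set phi := chart_at (lg_one G) in Ne mu1r mu1l NK aphi dphi cphi oO CO nz.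
pose e := phi (lg_one G).
pose U := psi @` chart_dom psi.
have UO y : U y -> O (e, y).
  by move=> [x dx <-]; exists (lg_one G, x) => //; split => //=; rewrite act1.
have OK a y : O (a, y) -> exists g x, [/\ chart_dom phi g, chart_dom psi x,
    chart_dom psi (act g x), phi g = a & psi x = y].
  by move=> [[g x] [[/= dg dx] dgx] [<- <-]]; exists g, x.
have F1 y : U y -> act_chart act psi (e, y) = y.
  move=> [x dx <-]; rewrite /act_chart /= (chart_imageK cpsi dx).
  by rewrite (chart_imageK cphi dphi) act1.
have FA y : U y -> \forall a \near e, \forall b \near e,
    act_chart act psi (mul_chart G (a, b), y) = act_chart act psi (a, act_chart act psi (b, y)).
  move=> Uy.
  have nN : \forall a \near e, N (a, e) by exact: near_slice1.
  have nO : \forall b \near e, O (b, y) by exact: near_slice1 (UO y Uy).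
  apply: filterS nN => a Na.
  (* This neighbourhood of [b] depends on [a]; on it the product stays inside the chart at 1. *)
  have nNb : \forall b \near e, N (a, b) by exact: near_slice2.
  apply: filterS2 nNb nO => b /NK[_ _ Kab] /OK[h [x [dh dx dhx hb xy]]].
  rewrite /act_chart Kab actM /= -hb -xy (chart_imageK cphi dh).
  by rewrite (chart_imageK cpsi dx) (chart_imageK cpsi dhx).
have FJ y : U y ->
    \forall a \near e, GLnH_Hstar (jacobian (fun z => act_chart act psi (a, z)) y).
  move=> Uy; have nO : \forall a \near e, O (a, y) by exact: near_slice1 (UO y Uy).
  apply: filterS nO => a /OK[g [x [dg dx dgx ga xy]]].
  have := act_jacobian hauto adpsi dx dgx; rewrite xy.
  suff -> : psi \o act g \o chart_inv psi = fun z => act_chart act psi (a, z) by [].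
  by apply/funext => z; rewrite /act_chart /= -ga (chart_imageK cphi dg).
have [rho [rhoL rhoM [v rhov]]] := local_representation oO CO oN CN oU UO F1 Ne mu1r mu1l
  FA FJ (imageP psi dx0) nz.
have rhoM' w z : rho (lie_bracket G w z) = rho w *m rho z - rho z *m rho w.
  by rewrite lie_bracketE rhoM.
have [F qF Frho] := @matrix_rep_g_quaternionic R _ (lie_algebra G) (lie_bracket G) rho
  rhoL rhoM'.
apply: (rho_min_exists qF); last first.
  by rewrite /real_dim dim_qspace addnn -mul2n mulnA mulnDr.
(* On real elements [F] is multiplication by [rho], so if it vanished, basis vectors would show
   every column of [rho v] to be zero. *)
exists (of_real v) => F0; apply: rhov; apply/matrixP => i j.
have : rho v *m (delta_mx j 0 : 'cV[quat R]_(n + 1)) = 0.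
  by rewrite -Frho F0 zero_lfunE.
by rewrite -colE => /matrixP/(_ i 0); rewrite !mxE.
Qed.
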